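(* Let $(H,R)$ be a finite dimensional quasi-triangular Hopf algebra over a field $k$ of characteristic zero. Then the following are equivalent: (1) The braided tensor category ${}_H\mathcal M$ is almost-symmetric. (2) $(H,R)$ is almost-triangular. (3) The left $H^{op}$-module algebra $H_R^*$ is quantum commutative with respect to $(H^{op},R^{21})$. (4) For any $h\in H$, $(R_2^2R_1^1)\cdot_{ad}h\otimes R_2^1R_1^2=h\otimes1_H$, that is, $(H,\cdot_{ad})$ is contained in the M\''uger center of ${}_H\mathcal M$.
   Context: $S$ is the antipode of $H$; Sweedler notation is used. A quasi-triangular Hopf algebra is a pair $(H,R)$, $R=R^1\otimes R^2\in H\otimes H$ invertible, with $R^1h_{(1)}\otimes R^2h_{(2)}=h_{(2)}R^1\otimes h_{(1)}R^2$ for all $h\in H$, $(\Delta\otimes id)(R)=R_1^1\otimes R_2^1\otimes R_1^2R_2^2$, $(id\otimes\Delta)(R)=R_1^1R_2^1\otimes R_2^2\otimes R_1^2$; $R_i=R_i^1\otimes R_i^2$ are copies of $R$, and $R^{21}=R^2\otimes R^1$. ${}_H\mathcal M$ is the category of finite dimensional left $H$-modules with braiding $\sigma(v\otimes w)=R^2w\otimes R^1v$. The M\''uger center of a braided category is the full subcategory of objects $V$ with $\sigma_{X,V}\sigma_{V,X}=id$ for all $X$. $(H,R)$ is almost-triangular if $R^{21}R\in Z(H)\otimes Z(H)$ (equivalently $R^{21}R\in Z(H)\otimes H$), $Z(H)$ the center of $H$. The transmuted braided group $H_R$ is the Hopf algebra in ${}_H\mathcal M$ given by the algebra $H$ with left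 adjoint action $h\cdot_{ad}h'=h_{(1)}h'S(h_{(2)})$, coproduct $\Delta_R(h)=h_{(1)}S(R^2)\otimes R^1\cdot_{ad}h_{(2)}$ and counit $\varepsilon$. $H_R^*$ is the convolution algebra dual to the coalgebra $(H,\Delta_R,\varepsilon)$: $\langle f*_Rf',h\rangle=(f\otimes f')(\Delta_R(h))$. It is a left $H^{op}$-module algebra, $h\in H^{op}$ acting by $f\mapsto f\circ(h\cdot_{ad}-)$. A left module algebra $A$ over a quasi-triangular Hopf algebra $(K,Q)$, $Q=Q^1\otimes Q^2$, is quantum commutative if $ab=(Q^2\cdot b)(Q^1\cdot a)$ for all $a,b\in A$. A coalgebra $C$ in a braided category is cocommutative if $\Delta_C=\sigma_{C,C}\circ\Delta_C$. A finite braided multitensor category $\mathcal C$ is almost-symmetric if the braided Hopf algebra $U(\mathcal C)=\int_{X\in\mathcal C}X\otimes X^*$ is cocommutative in $\mathcal C$; for $\mathcal C={}_H\mathcal M$, $U(\mathcal C)$ is precisely $H_R$. *)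

(* Defs.v *)
From HB Require Import structures.
From mathcomp Require Import all_boot all_algebra all_field.

Set Implicit Arguments.
Unset Strict Implicit.
Unset Printing Implicit Defensive.

Import GRing.Theory.
Local Open Scope ring_scope.

(* The tensor product of two finite dimensional spaces is represented by the
   matrices of coordinates in the products of the vectors of the bases
   [vbasis fullv]; [tlift_pure] and [tlift_unique] are its universal
   property. *)
Section Tensor.
Context {k : fieldType}.

Definition tens (V W : vectType k) : Type := 'M[k]_(\dim {:V}, \dim {:W}).
HB.instance Definition _ V W := Vector.on (tens V W).

Definition tpure (V W : vectType k) (v : V) (w : W) : tens V W :=
  \matrix_(i, j) (coord (vbasis fullv) i v * coord (vbasis fullv) j w).

(* Defined for every F, but meaningful for bilinear F only. *)
Definition tlift (V W : vectType k) (U : lmodType k) (F : V -> W -> U)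
    (t : tens V W) : U :=
  \sum_i \sum_j t i j *: F (vbasis fullv)`_i (vbasis fullv)`_j.

End Tensor.

Notation "v \ox w" := (tpure v w) (at level 45, left associativity) : ring_scope.
(* Sweedler notation: a \ox b stands for the element t, and E is bilinear in
   a and b. *)
Notation "\sw_ ( a , b <- t ) E" := (tlift (fun a b => E) t)
  (at level 46, a name, b name, t at level 200, E at level 46,
   format "\sw_ ( a ,  b  <-  t )  E") : ring_scope.

Section TensorTheory.
Context {k : fieldType}.
Implicit Types V W : vectType k.

Definition bilin V W (U : lmodType k) (F : V -> W -> U) :=
  (forall w, linear (F^~ w)) /\ (forall v, linear (F v)).

Lemma tlift_is_linear V W (U : lmodType k) (F : V -> W -> U) :
  linear (tlift F).
Proof.
move=> c s t; rewrite /tlift scaler_sumr -big_split; apply: eq_bigr => i _ /=.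
rewrite scaler_sumr -big_split; apply: eq_bigr => j _ /=.
by rewrite !mxE scalerDl scalerA.
Qed.
HB.instance Definition _ V W (U : lmodType k) (F : V -> W -> U) :=
  GRing.isLinear.Build k (tens V W) U _ (tlift F) (tlift_is_linear F).

Lemma tpure_bilin V W : bilin (@tpure k V W).
Proof.
split=> x c y z; apply/matrixP=> i j; rewrite !mxE linearP /=.
  by rewrite mulrDl mulrA.
by rewrite mulrDr mulrCA.
Qed.

Lemma tlift_pure V W (U : lmodType k) (F : V -> W -> U) v w :
  bilin F -> tlift F (v \ox w) = F v w.
Proof.
case=> Fl Fr.
pose Fl' w' : {linear V -> U} :=
  HB.pack (F^~ w') (GRing.isLinear.Build k V U _ _ (Fl w')).
pose Fr' v' : {linear W -> U} :=
  HB.pack (F v') (GRing.isLinear.Build k W U _ _ (Fr v')).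
have Ev i : F (vbasis {:V})`_i w =
    \sum_j coord (vbasis {:W}) j w *: F (vbasis {:V})`_i (vbasis {:W})`_j.
  rewrite -[LHS]/(Fr' _ w) [in LHS](coord_vbasis (memvf w)) linear_sum.
  by apply: eq_bigr => j _; rewrite linearZ.
rewrite -[RHS]/(Fl' w v) [in RHS](coord_vbasis (memvf v)) linear_sum.
apply: eq_bigr => i _; rewrite linearZ /= Ev scaler_sumr.
by apply: eq_bigr => j _; rewrite mxE scalerA.
Qed.

Lemma tlift_id V W (t : tens V W) : \sw_(a, b <- t) (a \ox b) = t.
Proof.
apply/matrixP=> i j; rewrite /tlift !summxE (bigD1 i) //= summxE (bigD1 j) //=.
have X : free (vbasis {:V}) by apply: (basis_free (vbasisP _)).
have Y : free (vbasis {:W}) by apply: (basis_free (vbasisP _)).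
rewrite !mxE !coord_free // !eqxx !mulr1 big1 ?addr0; last first.
  by move=> j' nj; rewrite !mxE !coord_free // (negPf nj) !mulr0.
rewrite big1 ?addr0 // => i' ni; rewrite summxE big1 // => j' _.
by rewrite !mxE !coord_free // (negPf ni) mul0r mulr0.
Qed.

Lemma tlift_unique V W (U : lmodType k) (f : {linear tens V W -> U}) t :
  f t = \sw_(a, b <- t) f (a \ox b).
Proof.
rewrite -{1}(tlift_id t) [in LHS]/tlift linear_sum; apply: eq_bigr => i _.
by rewrite linear_sum; apply: eq_bigr => j _; rewrite linearZ.
Qed.

Lemma eq_tlift V W (U : lmodType k) (F G : V -> W -> U) t :
  (forall a b, F a b = G a b) -> tlift F t = tlift G t.
Proof. by move=> e; do 2![apply: eq_bigr => ? _]; rewrite e. Qed.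

Lemma tlift_fun_linear V W (U : lmodType k) (F G : V -> W -> U) c t :
  \sw_(a, b <- t) (c *: F a b + G a b) = c *: tlift F t + tlift G t.
Proof.
rewrite /tlift scaler_sumr -big_split; apply: eq_bigr => i _ /=.
rewrite scaler_sumr -big_split; apply: eq_bigr => j _ /=.
by rewrite scalerDr !scalerA mulrC.
Qed.

Lemma linear_tlift V W (U U' : lmodType k) (f : {linear U -> U'})
    (F : V -> W -> U) t : f (tlift F t) = \sw_(a, b <- t) f (F a b).
Proof.
rewrite /tlift linear_sum; apply: eq_bigr => i _.
by rewrite linear_sum; apply: eq_bigr => j _; rewrite linearZ.
Qed.

Lemma tliftE V W (U V' : vectType k) (F : V -> W -> 'Hom(V', U)) t x :
  (tlift F t) x = \sw_(a, b <- t) F a b x.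
Proof.
rewrite /tlift sum_lfunE; apply: eq_bigr => i _.
by rewrite sum_lfunE; apply: eq_bigr => j _; rewrite lfunE.
Qed.

Lemma exchange_tlift V W V' W' (U : lmodType k)
    (F : V -> W -> V' -> W' -> U) t s :
  \sw_(a, b <- t) (\sw_(c, d <- s) F a b c d) =
  \sw_(c, d <- s) (\sw_(a, b <- t) F a b c d).
Proof.
rewrite /tlift.
transitivity (\sum_i \sum_j \sum_i' \sum_j' (t i j * s i' j') *:
   F (vbasis fullv)`_i (vbasis fullv)`_j (vbasis fullv)`_i' (vbasis fullv)`_j').
  apply: eq_bigr => i _; apply: eq_bigr => j _; rewrite scaler_sumr.
  apply: eq_bigr => i' _; rewrite scaler_sumr; apply: eq_bigr => j' _.
  by rewrite scalerA.
under eq_bigr do rewrite exchange_big /=; rewrite exchange_big /=.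
apply: eq_bigr => i' _.
under eq_bigr do rewrite exchange_big /=; rewrite exchange_big /=.
apply: eq_bigr => j' _; rewrite scaler_sumr; apply: eq_bigr => i _.
rewrite scaler_sumr; apply: eq_bigr => j _.
by rewrite scalerA mulrC.
Qed.

Definition tmap V W V' W' (f : 'Hom(V, V')) (g : 'Hom(W, W')) :
    'Hom(tens V W, tens V' W') :=
  linfun (tlift (fun v w => f v \ox g w)).

Lemma tmapE V W V' W' (f : 'Hom(V, V')) (g : 'Hom(W, W')) v w :
  tmap f g (v \ox w) = f v \ox g w.
Proof.
by rewrite lfunE /= tlift_pure //; split=> x c y z; rewrite linearP;
  apply tpure_bilin.
Qed.

Definition tflip V W (t : tens V W) : tens W V := \sw_(a, b <- t) (b \ox a).

(* The subspace of the tensor product spanned by the u \ox v, with u in U and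
   v in V. *)
Definition tensv V W (A : {vspace V}) (B : {vspace W}) : {vspace tens V W} :=
  <<[seq a \ox b | a <- vbasis A, b <- vbasis B]>>%VS.

Definition tens_mul (A B : falgType k) (s t : tens A B) : tens A B :=
  \sw_(a, b <- s) (\sw_(c, d <- t) ((a * c) \ox (b * d))).

End TensorTheory.

Arguments tlift_fun_linear {k V W U}.

Record lmodule (k : fieldType) (A : falgType k) := LModule {
  lmodule_sort :> vectType k;
  act : A -> 'End(lmodule_sort);
  act_is_linear : linear act;
  act1 : forall v, act 1 v = v;
  actM : forall a b v, act (a * b) v = act a (act b v)
}.
Arguments act {k A l}.

Definition lmodule_hom (k : fieldType) (A : falgType k) (V W : lmodule A)
    (f : 'Hom(V, W)) : Prop :=
  forall a v, f (act a v) = act a (f v).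

(* The algebra A^op; MathComp's A^c has no structure of algebra. *)
Section Opposite.
Context {k : fieldType}.

Definition algop (A : falgType k) : Type := A.

Section Instances.
Variable A : falgType k.
HB.instance Definition _ := Vector.copy (algop A) A.
Definition op_mul (a b : algop A) : algop A := (b : A) * (a : A).
Fact op_mulA : associative op_mul.
Proof. by move=> a b c; rewrite /op_mul mulrA. Qed.
Fact op_mul1 : left_id (1 : A) op_mul. Proof. exact: mulr1. Qed.
Fact op_1mul : right_id (1 : A) op_mul. Proof. exact: mul1r. Qed.
Fact op_mulDl : left_distributive op_mul +%R.
Proof. by move=> a b c; exact: mulrDr. Qed.
Fact op_mulDr : right_distributive op_mul +%R.
Proof. by move=> a b c; exact: mulrDl. Qed.
Fact op_1neq0 : (1 : A) != 0 :> algop A. Proof. exact: oner_neq0. Qed.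
HB.instance Definition _ := GRing.Zmodule_isNzRing.Build (algop A)
  op_mulA op_mul1 op_1mul op_mulDl op_mulDr op_1neq0.
Fact op_scalerAl (c : k) (a b : algop A) :
  c *: op_mul a b = op_mul (c *: a) b.
Proof. exact: (@scalerAr k A c b a). Qed.
HB.instance Definition _ :=
  GRing.Lmodule_isLalgebra.Build k (algop A) op_scalerAl.
Fact op_scalerAr (c : k) (a b : algop A) :
  c *: op_mul a b = op_mul a (c *: b).
Proof. exact: (@scalerAl k A c b a). Qed.
HB.instance Definition _ :=
  GRing.Lalgebra_isAlgebra.Build k (algop A) op_scalerAr.
HB.instance Definition _ := Algebra_isFalgebra.Build k (algop A).
End Instances.

End Opposite.


Record hopfAlgebra (k : fieldType) := HopfAlgebra {
  hopf_sort :> falgType k;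
  comul : {linear hopf_sort -> tens hopf_sort hopf_sort};
  counit : {linear hopf_sort -> k^o};
  antipode : {linear hopf_sort -> hopf_sort};
  comul_assoc : forall h,
    \sw_(a, b <- comul h) \sw_(a1, a2 <- comul a) (a1 \ox (a2 \ox b)) =
    \sw_(a, b <- comul h) \sw_(b1, b2 <- comul b) (a \ox (b1 \ox b2));
  comul_counitl : forall h, \sw_(a, b <- comul h) (counit a *: b) = h;
  comul_counitr : forall h, \sw_(a, b <- comul h) (counit b *: a) = h;
  comul1 : comul 1 = 1 \ox 1;
  comulM : forall g h, comul (g * h) = tens_mul (comul g) (comul h);
  counit1 : counit 1 = 1;
  counitM : forall g h, counit (g * h) = counit g * counit h;
  antipodel : forall h, \sw_(a, b <- comul h) (antipode a * b) = (counit h)%:A;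
  antipoder : forall h, \sw_(a, b <- comul h) (a * antipode b) = (counit h)%:A
}.
Arguments comul {k h} : rename.
Arguments counit {k h} : rename.
Arguments antipode {k h} : rename.

Section LinearityLemmas.
Context {k : fieldType}.
Implicit Types (U V W : lmodType k) (A : falgType k).

Lemma linfunE_lin (V W : vectType k) (f : V -> W) :
  linear f -> linfun f =1 f.
Proof.
move=> lf; pose F : {linear V -> W} :=
  HB.pack f (GRing.isLinear.Build k V W _ _ lf).
exact: (lfunE F).
Qed.
Lemma lin_id U : linear (fun x : U => x). Proof. by []. Qed.
Lemma lin_app U V W (g : {linear V -> W}) (f : U -> V) :
  linear f -> linear (fun x => g (f x)).
Proof. by move=> lf c x y; rewrite lf linearP. Qed.
Lemma lin_mull U A (f : U -> A) a : linear f -> linear (fun x => f x * a).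
Proof. by move=> lf c x y; rewrite lf mulrDl scalerAl. Qed.
Lemma lin_mulr U A (f : U -> A) a : linear f -> linear (fun x => a * f x).
Proof. by move=> lf c x y; rewrite lf mulrDr scalerAr. Qed.
Lemma lin_scalel U V (f : U -> k^o) (v : V) :
  linear f -> linear (fun x => (f x : k) *: v).
Proof. by move=> lf c x y; rewrite lf scalerDl scalerA. Qed.
Lemma lin_scaler U V (f : U -> V) (e : k) :
  linear f -> linear (fun x => e *: f x).
Proof. by move=> lf c x y; rewrite lf scalerDr !scalerA mulrC. Qed.
Lemma lin_tpurel U (V W : vectType k) (f : U -> V) (w : W) :
  linear f -> linear (fun x => f x \ox w).
Proof. by move=> lf c x y; rewrite lf; apply tpure_bilin. Qed.
Lemma lin_tpurer U (V W : vectType k) (f : U -> W) (v : V) :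
  linear f -> linear (fun x => v \ox f x).
Proof. by move=> lf c x y; rewrite lf; apply tpure_bilin. Qed.
Lemma lin_tlift U V (V1 W1 : vectType k) (F : U -> V1 -> W1 -> V) t :
  (forall a b, linear (fun x => F x a b)) -> linear (fun x => tlift (F x) t).
Proof.
move=> lF c x y; rewrite -tlift_fun_linear; apply: eq_tlift => a b; exact: lF.
Qed.
Lemma lin_arg U V (V1 W1 : vectType k) (F : V1 -> W1 -> V)
    (g : U -> tens V1 W1) :
  linear g -> linear (fun x => tlift F (g x)).
Proof. by move=> lg c x y; rewrite lg linearP. Qed.
Lemma lin_compl U (V1 V2 V3 : vectType k) (f : U -> 'Hom(V2, V3))
    (g : 'Hom(V1, V2)) : linear f -> linear (fun x => (f x \o g)%VF).
Proof.
move=> lf c x y; apply/lfunP=> v.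
by rewrite lf !(comp_lfunE, add_lfunE, scale_lfunE).
Qed.
Lemma lin_compr U (V1 V2 V3 : vectType k) (f : U -> 'Hom(V1, V2))
    (g : 'Hom(V2, V3)) : linear f -> linear (fun x => (g \o f x)%VF).
Proof.
move=> lf c x y; apply/lfunP=> v.
by rewrite lf !(comp_lfunE, add_lfunE, scale_lfunE) linearP.
Qed.
Lemma lin_lfun U (V1 V2 : vectType k) (f : U -> 'Hom(V1, V2)) v :
  linear f -> linear (fun x => f x v).
Proof. by move=> lf c x y; rewrite lf add_lfunE scale_lfunE. Qed.
Lemma lin_tmapl U (V1 V2 W1 W2 : vectType k) (f : U -> 'Hom(V1, V2))
    (g : 'Hom(W1, W2)) : linear f -> linear (fun x => tmap (f x) g).
Proof.
move=> lf c x y; apply/lfunP=> t.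
rewrite !(add_lfunE, scale_lfunE) /tmap !lfunE /= -tlift_fun_linear.
apply: eq_tlift => a b; rewrite lf !(add_lfunE, scale_lfunE).
by apply (tpure_bilin V2 W2).1.
Qed.
Lemma lin_tmapr U (V1 V2 W1 W2 : vectType k) (f : 'Hom(V1, V2))
    (g : U -> 'Hom(W1, W2)) : linear g -> linear (fun x => tmap f (g x)).
Proof.
move=> lg c x y; apply/lfunP=> t.
rewrite !(add_lfunE, scale_lfunE) /tmap !lfunE /= -tlift_fun_linear.
apply: eq_tlift => a b; rewrite lg !(add_lfunE, scale_lfunE).
by apply (tpure_bilin V2 W2).2.
Qed.
End LinearityLemmas.

Ltac lin := cbv beta; solve [repeat first
  [ apply: lin_id | apply: lin_mull | apply: lin_mulr
  | apply: lin_tpurel | apply: lin_tpurer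
  | apply: lin_compl | apply: lin_compr | apply: lin_tmapl | apply: lin_tmapr
  | apply: lin_scalel | apply: lin_scaler
  | apply: lin_tlift => ? ? | apply: lin_arg | apply: lin_app | apply: lin_lfun ]].
Ltac bil := split=> ?; lin.

Section HopfTheory.
Context {k : fieldType} (H : hopfAlgebra k).
Implicit Types a b g h : H.

Lemma comulA (U : lmodType k) (T : H -> H -> H -> U) h :
  (forall y z, linear (fun x => T x y z)) ->
  (forall x z, linear (fun y => T x y z)) ->
  (forall x y, linear (fun z => T x y z)) ->
  \sw_(a, b <- comul h) \sw_(a1, a2 <- comul a) T a1 a2 b =
  \sw_(a, b <- comul h) \sw_(b1, b2 <- comul b) T a b1 b2.
Proof.
move=> T1 T2 T3; pose L : {linear _ -> U} := tlift (fun x => tlift (T x)).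
have LE x y z : L (x \ox (y \ox z)) = T x y z.
  rewrite -[LHS]/(tlift (fun x => tlift (T x)) _) tlift_pure ?tlift_pure //; split=> //.
  - by move=> ?; apply: lin_tlift.
  - by move=> ?; apply: lin_arg.
have := congr1 L (comul_assoc h); rewrite !linear_tlift.
under eq_tlift => a b do rewrite linear_tlift.
under [in RHS]eq_tlift => a b do rewrite linear_tlift.
under eq_tlift => a b do (under eq_tlift do rewrite LE).
by under [in RHS]eq_tlift => a b do (under eq_tlift do rewrite LE).
Qed.

Lemma comulM_sw (U : lmodType k) (F : H -> H -> U) g h : bilin F ->
  \sw_(x, y <- comul (g * h)) F x y =
  \sw_(a, b <- comul g) \sw_(c, d <- comul h) F (a * c) (b * d).
Proof.
move=> bF; rewrite comulM /tens_mul linear_tlift; apply: eq_tlift => a b.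
by rewrite linear_tlift; apply: eq_tlift => c d; rewrite /= tlift_pure.
Qed.

Lemma antipode1 : antipode 1 = 1 :> H.
Proof.
have := antipodel (1 : H); rewrite comul1 counit1 scale1r tlift_pure ?mulr1 //.
by bil.
Qed.


Lemma counitl_sw (U : lmodType k) (f : H -> U) h : linear f ->
  \sw_(a, b <- comul h) ((counit a : k) *: f b) = f h.
Proof.
move=> lf; pose g : {linear H -> U} :=
  HB.pack f (GRing.isLinear.Build k H U _ _ lf).
rewrite -[RHS]/(g h) -[in RHS](comul_counitl h) linear_tlift.
by apply: eq_tlift => a b; rewrite linearZ.
Qed.

Lemma counitr_sw (U : lmodType k) (f : H -> U) h : linear f ->
  \sw_(a, b <- comul h) ((counit b : k) *: f a) = f h.
Proof.
move=> lf; pose g : {linear H -> U} :=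
  HB.pack f (GRing.isLinear.Build k H U _ _ lf).
rewrite -[RHS]/(g h) -[in RHS](comul_counitr h) linear_tlift.
by apply: eq_tlift => a b; rewrite linearZ.
Qed.

Lemma tlift_mull (V W : vectType k) (F : V -> W -> H) t x :
  tlift F t * x = \sw_(a, b <- t) (F a b * x).
Proof. by rewrite -[LHS]/((x \o* idfun) (tlift F t)) linear_tlift. Qed.

Lemma tlift_mulr (V W : vectType k) (F : V -> W -> H) t x :
  x * tlift F t = \sw_(a, b <- t) (x * F a b).
Proof. by rewrite -[LHS]/((x \*o idfun) (tlift F t)) linear_tlift. Qed.

Lemma antipodeM a b : antipode (a * b) = antipode b * antipode a.
Proof.
pose S := @antipode k H.
transitivity (\sw_(a1, a2 <- comul a) \sw_(b1, b2 <- comul b)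
    ((\sw_(x, y <- comul (a1 * b1)) (S x * y)) * (S b2 * S a2))); last first.
  under eq_tlift => a1 a2.
    under eq_tlift => b1 b2.
      rewrite antipodel counitM -scalerAl mul1r mulrC -scalerA; over.
    rewrite counitl_sw; last by lin.
    over.
  by rewrite (counitl_sw (f := fun a2 => S b * S a2)) //; lin.
transitivity (\sw_(a1, a2 <- comul a) \sw_(a11, a12 <- comul a1)
  \sw_(b1, b2 <- comul b) \sw_(b11, b12 <- comul b1)
    (S (a11 * b11) * (a12 * b12) * (S b2 * S a2))); last first.
  apply: eq_tlift => a1 a2; rewrite exchange_tlift; apply: eq_tlift => b1 b2.
  rewrite (comulM_sw (F := fun x y => S x * y)); last by bil.
  rewrite tlift_mull; apply: eq_tlift => a11 a12.
  by rewrite tlift_mull.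
rewrite (comulA (T := fun x y z => \sw_(b1, b2 <- comul b)
  \sw_(b11, b12 <- comul b1) (S (x * b11) * (y * b12) * (S b2 * S z))));
  [ | by move=> ? ?; lin.. ].
transitivity (\sw_(x, q <- comul a) \sw_(u, r <- comul b)
    ((counit r : k) *: ((counit q : k) *: S (x * u)))).
  under eq_tlift => x q.
    rewrite counitr_sw; last by lin.
    over.
  by rewrite (counitr_sw (f := fun x => S (x * b))) //; lin.
apply: eq_tlift => x q; rewrite exchange_tlift.
under [RHS]eq_tlift => b1 b2 do rewrite exchange_tlift.
rewrite (comulA (T := fun u v w => \sw_(y, z <- comul q)
  (S (x * u) * (y * v) * (S w * S z)))); [ | by move=> ? ?; lin.. ].
apply: eq_tlift => u r.
transitivity (\sw_(y, z <- comul q) (S (x * u) * y *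
   (\sw_(v, w <- comul r) (v * S w)) * S z)).
  rewrite antipoder.
  under eq_tlift do rewrite -scalerAr mulr1 -scalerAl -mulrA.
  rewrite -(linear_tlift ( *:%R (counit r : k)));congr (_ *: _).
  by rewrite -tlift_mulr antipoder -scalerAr mulr1.
rewrite exchange_tlift; apply: eq_tlift => y z.
rewrite tlift_mulr tlift_mull; apply: eq_tlift => v w.
by rewrite !mulrA.
Qed.

Lemma tmap_comp (V V' V'' W W' W'' : vectType k) (f : 'Hom(V, V'))
    (f' : 'Hom(V', V'')) (g : 'Hom(W, W')) (g' : 'Hom(W', W'')) t :
  tmap f' g' (tmap f g t) = tmap (f' \o f)%VF (g' \o g)%VF t.
Proof.
rewrite -(tlift_id t) !linear_tlift /=; apply: eq_tlift => v w.
by rewrite !tmapE !comp_lfunE.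
Qed.

Definition tens_act (V W : lmodule H) (h : H) : 'End(tens V W) :=
  \sw_(a, b <- comul h) tmap (act a) (act b).

Fact tens_act_linear (V W : lmodule H) : linear (tens_act V W).
Proof. by apply: lin_arg => c x y; rewrite linearP. Qed.

Fact act_bilin (V W : lmodule H) :
  bilin (fun a b => tmap (act a : 'End(V)) (act b : 'End(W))).
Proof.
by split=> x; [apply: lin_tmapl | apply: lin_tmapr]; exact: act_is_linear.
Qed.

Fact tens_act1 (V W : lmodule H) t : tens_act V W 1 t = t.
Proof.
rewrite /tens_act comul1 tlift_pure; last exact: act_bilin.
rewrite -[RHS]tlift_id -[in LHS](tlift_id t) linear_tlift.
by apply: eq_tlift => v w /=; rewrite tmapE !act1.
Qed.

Fact tens_actM (V W : lmodule H) g h t :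
  tens_act V W (g * h) t = tens_act V W g (tens_act V W h t).
Proof.
rewrite /tens_act comulM_sw; last exact: act_bilin.
rewrite !tliftE; apply: eq_tlift => a b; rewrite !tliftE linear_tlift.
apply: eq_tlift => c d /=; rewrite tmap_comp.
by congr (tmap _ _ _); apply/lfunP=> v; rewrite comp_lfunE actM.
Qed.

Definition tens_lmodule (V W : lmodule H) : lmodule H :=
  LModule (tens_act_linear V W) (@tens_act1 V W) (@tens_actM V W).

Definition precomp (V W : vectType k) (f : 'Hom(V, W)) :
    'Hom('Hom(W, k^o), 'Hom(V, k^o)) :=
  linfun (fun xi => (xi \o f)%VF).

Lemma precompE (V W : vectType k) (f : 'Hom(V, W)) xi :
  precomp f xi = (xi \o f)%VF.
Proof.
by apply: linfunE_lin; apply: lin_compl; exact: lin_id.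
Qed.

Lemma precomp_linear (V W : vectType k) : linear (@precomp V W).
Proof.
move=> c f g; apply/lfunP=> xi; apply/lfunP=> v.
rewrite !(add_lfunE, scale_lfunE) !precompE.
by rewrite !(add_lfunE, scale_lfunE, comp_lfunE) linearP.
Qed.

(* The dual X^* of the rigid category: (h xi)(x) = xi (S(h) x). *)
Definition dual_act (V : lmodule H) (h : H) : 'End('Hom(V, k^o)) :=
  precomp (act (antipode h)).

Fact dual_act_linear (V : lmodule H) : linear (dual_act V).
Proof.
by move=> c x y; rewrite /dual_act linearP act_is_linear precomp_linear.
Qed.

Fact dual_act1 (V : lmodule H) xi : dual_act V 1 xi = xi.
Proof.
by apply/lfunP=> v; rewrite precompE comp_lfunE antipode1 act1.
Qed.

Fact dual_actM (V : lmodule H) g h xi :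
  dual_act V (g * h) xi = dual_act V g (dual_act V h xi).
Proof.
by apply/lfunP=> v; rewrite !precompE !comp_lfunE antipodeM actM.
Qed.

Definition dual_lmodule (V : lmodule H) : lmodule H :=
  LModule (dual_act_linear V) (@dual_act1 V) (@dual_actM V).

Definition adj_act (h : H) : 'End(H) :=
  \sw_(a, b <- comul h) (amull a \o amulr (antipode b))%VF.

Lemma adj_actE h x : adj_act h x = \sw_(a, b <- comul h) (a * x * antipode b).
Proof.
rewrite /adj_act tliftE; apply: eq_tlift => a b.
by rewrite comp_lfunE !lfunE /= mulrA.
Qed.

Fact adj_act_linear : linear adj_act.
Proof. by lin. Qed.

Fact adj_act1 x : adj_act 1 x = x.
Proof.
rewrite adj_actE comul1 tlift_pure; first by rewrite antipode1 mul1r mulr1.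
by bil.
Qed.

Fact adj_actM g h x : adj_act (g * h) x = adj_act g (adj_act h x).
Proof.
rewrite !adj_actE comulM_sw; last by bil.
apply: eq_tlift => a b; rewrite tlift_mulr tlift_mull.
by apply: eq_tlift => c d; rewrite antipodeM !mulrA.
Qed.

Definition adj_lmodule : lmodule H :=
  LModule adj_act_linear adj_act1 adj_actM.

End HopfTheory.

Section QuasiTriangular.
Context {k : fieldType} {H : hopfAlgebra k}.
Implicit Types (R : tens H H) (V W X Y U : lmodule H).

Record quasi_triangular R : Prop := QuasiTriangular {
  qt_invertible : exists R',
    tens_mul R R' = 1 \ox 1 /\ tens_mul R' R = 1 \ox 1;
  qt_comul : forall h,
    \sw_(r1, r2 <- R) \sw_(a, b <- comul h) ((r1 * a) \ox (r2 * b)) =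
    \sw_(r1, r2 <- R) \sw_(a, b <- comul h) ((b * r1) \ox (a * r2));
  qt_comull :
    \sw_(r1, r2 <- R) \sw_(a, b <- comul r1) (a \ox (b \ox r2)) =
    \sw_(r1, r2 <- R) \sw_(s1, s2 <- R) (r1 \ox (s1 \ox (r2 * s2)));
  qt_comulr :
    \sw_(r1, r2 <- R) \sw_(a, b <- comul r2) (r1 \ox (a \ox b)) =
    \sw_(r1, r2 <- R) \sw_(s1, s2 <- R) ((r1 * s1) \ox (s2 \ox r2))
}.

Definition almost_triangular R : Prop :=
  tens_mul (tflip R) R \in tensv 'Z({:H})%VS 'Z({:H})%VS.

Definition braid R V W (t : tens V W) : tens W V :=
  \sw_(v, w <- t) \sw_(r1, r2 <- R) (act r2 w \ox act r1 v).

Definition in_muger_center R V : Prop :=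
  forall X (t : tens V X), braid R (braid R t) = t.

Definition transmuted_comul R (h : H) : tens H H :=
  \sw_(a, b <- comul h) \sw_(r1, r2 <- R)
    ((a * antipode r2) \ox adj_act r1 b).

(* A dinatural family from U to X \ox X^*, X ranging over all modules. *)
Definition dinatural U
    (p : forall X, 'Hom(U, tens_lmodule X (dual_lmodule X))) : Prop :=
  forall X Y (f : 'Hom(X, Y)), lmodule_hom f -> forall u : U,
    tmap f \1%VF (p X u) = tmap \1%VF (precomp f) (p Y u).

Record is_end U (p : forall X, 'Hom(U, tens_lmodule X (dual_lmodule X))) :
    Prop := IsEnd {
  end_hom : forall X, lmodule_hom (p X);
  end_dinatural : dinatural p;
  end_universal : forall W
      (q : forall X, 'Hom(W, tens_lmodule X (dual_lmodule X))),
    (forall X, lmodule_hom (q X)) -> dinatural q ->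
    exists! f : 'Hom(W, U),
      lmodule_hom f /\ forall X w, p X (f w) = q X w
}.

Definition dual_basis (V : vectType k) (i : 'I_(\dim {:V})) : 'Hom(V, k^o) :=
  linfun (coord (vbasis fullv) i : V -> k^o).

(* The canonical isomorphism from (X \ox Y)^* to Y^* \ox X^*, the inverse of
   the one sending eta \ox xi to x \ox y |-> xi x * eta y. *)
Definition dual_tens (V W : vectType k) (phi : 'Hom(tens V W, k^o)) :
    tens 'Hom(W, k^o) 'Hom(V, k^o) :=
  \sum_(i < \dim {:V}) \sum_(j < \dim {:W})
    (phi ((vbasis fullv)`_i \ox (vbasis fullv)`_j) : k) *:
      (dual_basis j \ox dual_basis i).

Lemma lfun_coord (V : vectType k) (xi : 'Hom(V, k^o)) :
  xi = \sum_(i < \dim {:V}) (xi (vbasis fullv)`_i : k) *: dual_basis i.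
Proof.
apply/lfunP=> v; rewrite [in LHS](coord_vbasis (memvf v)) linear_sum sum_lfunE.
by apply: eq_bigr => i _; rewrite linearZ scale_lfunE linfunE_lin /=; [exact: mulrC | exact: linearP].
Qed.

Lemma dual_tensE (V W : vectType k) (phi : 'Hom(tens V W, k^o))
    (xi : 'Hom(V, k^o)) (eta : 'Hom(W, k^o)) :
  (forall x y, phi (x \ox y) = xi x * eta y) -> dual_tens phi = eta \ox xi.
Proof.
move=> phiE; rewrite [in RHS](lfun_coord xi) [in RHS](lfun_coord eta).
have lr (w : 'Hom(W, k^o)) : linear (tpure w : 'Hom(V, k^o) -> _).
  exact: (tpure_bilin _ _).2.
have ll (v : 'Hom(V, k^o)) : linear ((@tpure k 'Hom(W, k^o) _)^~ v).
  exact: (tpure_bilin _ _).1.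
pose fr w : {linear 'Hom(V, k^o) -> _} :=
  HB.pack (tpure w : 'Hom(V, k^o) -> _)
    (GRing.isLinear.Build k _ _ _ _ (lr w)).
pose fl v : {linear 'Hom(W, k^o) -> _} :=
  HB.pack ((@tpure k 'Hom(W, k^o) _)^~ v)
    (GRing.isLinear.Build k _ _ _ _ (ll v)).
rewrite -[RHS]/(fr _ _) linear_sum; apply: eq_bigr => i _.
rewrite linearZ /= -[X in _ = _ *: X]/(fl _ _) linear_sum scaler_sumr.
by apply: eq_bigr => j _; rewrite linearZ scalerA phiE.
Qed.

(* The isomorphism from (X \ox Y) \ox (X \ox Y)^* to
   (X \ox X^* ) \ox (Y \ox Y^* ) that identifies (X \ox Y)^* with Y^* \ox X^*
   and then moves X^* across Y \ox Y^* with the braiding of Y \ox Y^* with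
   X^*. *)
Definition split_end R X Y
    (z : tens_lmodule (tens_lmodule X Y) (dual_lmodule (tens_lmodule X Y))) :
    tens (tens X (dual_lmodule X)) (tens Y (dual_lmodule Y)) :=
  \sw_(xy, phi <- z) \sw_(x, y <- xy) \sw_(eta, xi <- dual_tens phi)
    \sw_(xi', m <-
      @braid R (tens_lmodule Y (dual_lmodule Y)) (dual_lmodule X)
        ((y \ox eta) \ox xi))
      ((x \ox xi') \ox m).

(* The coproduct of the end is determined by its components. For U = (H, ad)
   and p X h = \sum_i (h x_i \ox x^i), the equation below reads
   D h = \sum h_(1) S(R^2) \ox ad R^1 h_(2), that is D = transmuted_comul R. *)
Definition is_end_comul R U
    (p : forall X, 'Hom(U, tens_lmodule X (dual_lmodule X)))
    (D : 'Hom(U, tens_lmodule U U)) : Prop :=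
  lmodule_hom D /\
  forall X Y u,
    tmap (p X) (p Y) (D u) = split_end R (p (tens_lmodule X Y) u).

(* As ends are unique up to a unique isomorphism, it does not matter which end
   is chosen. *)
Definition almost_symmetric R : Prop :=
  exists U (p : forall X, 'Hom(U, tens_lmodule X (dual_lmodule X)))
    (D : 'Hom(U, tens_lmodule U U)),
  [/\ is_end p, is_end_comul R p D & forall u, braid R (D u) = D u].

(* H_R^* is the space of linear forms on H; H acts through f |-> f \o ad h,
   which makes it a left module over H^op. *)
Definition tdual_act (h : H) : 'End('Hom(H, k^o)) := precomp (adj_act h).

Fact tdual_act_linear : linear (tdual_act : algop H -> _).
Proof.
by move=> c x y; rewrite -precomp_linear -adj_act_linear.
Qed.

Fact tdual_act1 xi : tdual_act 1 xi = xi.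
Proof.
by apply/lfunP=> v; rewrite precompE comp_lfunE adj_act1.
Qed.

Fact tdual_actM (g h : algop H) xi :
  tdual_act (g * h) xi = tdual_act g (tdual_act h xi).
Proof.
apply/lfunP=> v; rewrite !precompE !comp_lfunE -adj_actM.
by [].
Qed.

Definition tdual_lmodule : lmodule (algop H) :=
  LModule tdual_act_linear tdual_act1 tdual_actM.

Definition tdual_mul R (f g : tdual_lmodule) : tdual_lmodule :=
  linfun (fun h : H => \sw_(a, b <- transmuted_comul R h)
    ((f : 'Hom(H, k^o)) a * (g : 'Hom(H, k^o)) b : k^o)).

Lemma tdual_mulE R (f g : 'Hom(H, k^o)) (h : H) :
  (tdual_mul R f g : 'Hom(H, k^o)) h =
  \sw_(a, b <- transmuted_comul R h) (f a * g b : k^o).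
Proof.
by apply: linfunE_lin; apply: lin_arg; rewrite /transmuted_comul; lin.
Qed.

End QuasiTriangular.

Definition quantum_commutative (k : fieldType) (K : falgType k)
    (A : lmodule K) (mul : A -> A -> A) (Q : tens K K) : Prop :=
  forall a b, mul a b = \sw_(q1, q2 <- Q) mul (act q2 b) (act q1 a).

(* Main.v *)
Require Import Defs.
From HB Require Import structures.
From mathcomp Require Import all_boot all_algebra all_field.

Set Implicit Arguments.
Unset Strict Implicit.
Unset Printing Implicit Defensive.

Import GRing.Theory.
Local Open Scope ring_scope.

(** Write Q = R^{21} R, and h.x for the adjoint action. All the conditions are
    compared with the triviality of the monodromy of (H, ad), which is
    Q^1.h \ox Q^2 = h \ox 1 for all h.

    Cocommutativity. The coproduct of the transmuted braided group has two
    expressions,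
      h_(1) S(R^2) \ox R^1.h_(2) = R^2.h_(2) \ox R^1 h_(1)
    ([transmuted_comulE]). Applying the braiding to the first one gives
      R^2.(Q^1.h_(2)) \ox R^1 h_(1) S(Q^2)
    ([braid_transmuted_comul]), which differs from the second one by the
    insertion of Q alone. So trivial monodromy implies cocommutativity. For the
    converse one cancels the outer copy of R and h_(1), and is left with
    Q^1.h \ox S(Q^2) = h \ox 1; the antipode is injective because its square is
    implemented by the Drinfeld element.

    Centrality. The formulas for (Delta \ox id) R and (id \ox Delta) R give
      Q^1.h \ox Q^2 = Q^1 h S(R_1^1) S(R_2^2) \ox R_2^1 Q^2 R_1^2
    ([adj_monodromy]). The factors coming from the two copies of R can be
    cancelled, so that trivial monodromy means that Q^1 is central. As Q commutes
    with the coproducts Delta(h), centrality of the first leg of Q forces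
    centrality of the second one ([monodromy_centl_centr]), that is
    almost-triangularity.

    Duality. Quantum commutativity of H_R^* is cocommutativity of the transmuted
    coproduct tested against all pairs of linear forms. The Mueger condition is
    the triviality of the monodromy tested against all modules, for which the
    regular module suffices.

    Ends. A tensor t in X \ox X^* is determined by the values
    [ev x t] of the corresponding linear map. The end of the X \ox X^* is H with
    the adjoint action, h having the component x |-> h x: a dinatural family is
    determined by its component at the regular module, evaluated at 1
    ([dinatural_act]). The coproduct of this end is the transmuted one
    ([adj_end_comul]), and any other end with its coproduct is compared to it
    through the isomorphism of ends, so that almost-symmetry is
    cocommutativity of the transmuted coproduct. *)

(** * Tensor products *)

Section TensorCalculus.
Context {k : fieldType}.
Implicit Types V W : vectType k.

(** These two serve for functions given by an expression, whose linearity is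
    a side condition discharged by [lin]. *)
Lemma linear_fun_tlift V W (U U' : lmodType k) (f : U -> U') (F : V -> W -> U) t :
  linear f -> f (tlift F t) = \sw_(a, b <- t) f (F a b).
Proof.
move=> lf; pose g : {linear U -> U'} :=
  HB.pack f (GRing.isLinear.Build k U U' _ _ lf).
exact: (linear_tlift g).
Qed.

Lemma linear_funZ (U U' : lmodType k) (f : U -> U') c x :
  linear f -> f (c *: x) = c *: f x.
Proof.
move=> lf; pose g : {linear U -> U'} :=
  HB.pack f (GRing.isLinear.Build k U U' _ _ lf).
by rewrite -[LHS]/(g _) linearZ.
Qed.

Lemma tlift_sw V W (V' W' : vectType k) (U : lmodType k) (F : V' -> W' -> U)
    (G : V -> W -> tens V' W') t :
  tlift F (\sw_(a, b <- t) G a b) = \sw_(a, b <- t) tlift F (G a b).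
Proof. exact: (linear_tlift (tlift F)). Qed.

Lemma scaler_tlift V W (U : lmodType k) (F : V -> W -> U) c t :
  c *: tlift F t = \sw_(a, b <- t) (c *: F a b).
Proof. exact: (linear_tlift ( *:%R c)). Qed.

Lemma tmap_tlift V W (V' W' V1 W1 : vectType k) (f : 'Hom(V, V')) (g : 'Hom(W, W'))
    (F : V1 -> W1 -> tens V W) t :
  tmap f g (tlift F t) = \sw_(a, b <- t) tmap f g (F a b).
Proof. exact: (linear_tlift (tmap f g)). Qed.

Lemma tlift3_pure (V1 V2 V3 : vectType k) (U : lmodType k)
    (T : V1 -> V2 -> V3 -> U) x y z :
  (forall y z, linear (fun x => T x y z)) ->
  (forall x z, linear (fun y => T x y z)) ->
  (forall x y, linear (fun z => T x y z)) ->
  tlift (fun x => tlift (T x)) (x \ox (y \ox z)) = T x y z.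
Proof.
move=> T1 T2 T3; rewrite !tlift_pure //; split=> // ?.
  by apply: lin_tlift.
by apply: lin_arg.
Qed.

Lemma tpureZl V W c (v : V) (w : W) :
  (c *: v) \ox w = c *: (v \ox w).
Proof. by apply/matrixP=> i j; rewrite !mxE linearZ /= mulrA. Qed.

Lemma tpureZr V W c (v : V) (w : W) : v \ox (c *: w) = c *: (v \ox w).
Proof. by apply/matrixP=> i j; rewrite !mxE linearZ /= mulrCA. Qed.

Lemma tpure_suml V W n (f : 'I_n -> V) (w : W) :
  (\sum_i f i) \ox w = \sum_i (f i \ox w).
Proof.
apply/matrixP=> i j; rewrite summxE !mxE linear_sum mulr_suml.
by apply: eq_bigr => l _; rewrite !mxE.
Qed.

Lemma tpure_sumr V W n (f : 'I_n -> W) (v : V) :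
  v \ox (\sum_i f i) = \sum_i (v \ox f i).
Proof.
apply/matrixP=> i j; rewrite summxE !mxE linear_sum mulr_sumr.
by apply: eq_bigr => l _; rewrite !mxE.
Qed.

Lemma tpure_tliftl V W V' W' (F : V' -> W' -> V) t (w : W) :
  tlift F t \ox w = \sw_(a, b <- t) (F a b \ox w).
Proof.
by rewrite /tlift tpure_suml; apply: eq_bigr => i _; rewrite tpure_suml;
  apply: eq_bigr => j _; rewrite tpureZl.
Qed.

Lemma tpure_tliftr V W V' W' (F : V' -> W' -> W) t (v : V) :
  v \ox tlift F t = \sw_(a, b <- t) (v \ox F a b).
Proof.
by rewrite /tlift tpure_sumr; apply: eq_bigr => i _; rewrite tpure_sumr;
  apply: eq_bigr => j _; rewrite tpureZr.
Qed.

Lemma coord_tensE V W (t : tens V W) i j :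
  t i j = \sw_(a, b <- t)
    (coord (vbasis fullv) i a * coord (vbasis fullv) j b : k^o).
Proof.
rewrite -[in LHS](tlift_id t) /tlift !summxE; apply: eq_bigr => i' _.
by rewrite summxE; apply: eq_bigr => j' _; rewrite !mxE.
Qed.

Lemma dual_basisE V (i : 'I_(\dim {:V})) (v : V) :
  dual_basis i v = coord (vbasis fullv) i v.
Proof. exact: lfunE. Qed.

Lemma tens_eq_dual V W (t t' : tens V W) :
  (forall (f : 'Hom(V, k^o)) (g : 'Hom(W, k^o)),
     \sw_(a, b <- t) (f a * g b : k^o) = \sw_(a, b <- t') (f a * g b : k^o)) ->
  t = t'.
Proof.
move=> E; apply/matrixP=> i j; rewrite !coord_tensE.
have := E (dual_basis i) (dual_basis j).
under eq_tlift do rewrite !dual_basisE.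
by under [in RHS]eq_tlift do rewrite !dual_basisE.
Qed.

Lemma tpure_tensv V W (A : {vspace V}) (B : {vspace W}) v w :
  v \in A -> w \in B -> v \ox w \in tensv A B.
Proof.
move=> vA wB; rewrite (coord_vbasis vA) (coord_vbasis wB).
rewrite tpure_suml memv_suml // => i _; rewrite tpureZl memvZ //.
rewrite tpure_sumr memv_suml // => j _; rewrite tpureZr memvZ //.
apply/memv_span/allpairsP.
exists ((vbasis A)`_i, (vbasis B)`_j); split=> //=; apply: mem_nth;
  by rewrite size_tuple.
Qed.

Lemma tensv_ind V W (U : lmodType k) (A : {vspace V})
    (B : {vspace W}) (f g : {linear tens V W -> U}) :
  (forall a b, a \in A -> b \in B -> f (a \ox b) = g (a \ox b)) ->
  forall t, t \in tensv A B -> f t = g t.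
Proof.
move=> fg t; rewrite /tensv; set s := [seq _ | _ <- _, _ <- _].
rewrite -[s]/(tval (in_tuple s)) => /coord_span ->.
rewrite !linear_sum; apply: eq_bigr => i _; rewrite !linearZ /=; congr (_ *: _).
have /allpairsP[[a b] [/= aA bB ->]] : s`_i \in s by exact: mem_nth.
by apply: fg; apply: vbasis_mem.
Qed.

(** A tensor is determined by its slices, and the projection fixes the slices
    that lie in [A]. *)
Lemma tlift_projl V W (A : {vspace V}) (t : tens V W) :
  (forall g : 'Hom(W, k^o), \sw_(a, b <- t) ((g b : k) *: a) \in A) ->
  \sw_(a, b <- t) (projv A a \ox b) = t.
Proof.
move=> tA; apply: tens_eq_dual => f g; rewrite tlift_sw.
transitivity (f (projv A (\sw_(a, b <- t) ((g b : k) *: a)))).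
  rewrite !linear_tlift; apply: eq_tlift => a b.
  by rewrite tlift_pure; [rewrite !linearZ /= mulrC | bil].
rewrite projv_id // linear_tlift; apply: eq_tlift => a b.
by rewrite linearZ /= mulrC.
Qed.

Lemma tlift_projr V W (B : {vspace W}) (t : tens V W) :
  (forall f : 'Hom(V, k^o), \sw_(a, b <- t) ((f a : k) *: b) \in B) ->
  \sw_(a, b <- t) (a \ox projv B b) = t.
Proof.
move=> tB; apply: tens_eq_dual => f g; rewrite tlift_sw.
transitivity (g (projv B (\sw_(a, b <- t) ((f a : k) *: b)))).
  rewrite !linear_tlift; apply: eq_tlift => a b.
  by rewrite tlift_pure; [rewrite !linearZ | bil].
by rewrite projv_id // linear_tlift; apply: eq_tlift => a b; rewrite linearZ.
Qed.

End TensorCalculus.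

Section Center.
Context {k : fieldType} (A : falgType k).

Lemma mem_center (a : A) : reflect (forall x, a * x = x * a) (a \in 'Z({:A})%VS).
Proof.
rewrite memv_cap memvf; apply: (iffP centvP) => [c x|c x _].
  by rewrite c ?memvf.
exact: c.
Qed.

(** Z \ox Z is the intersection of Z \ox A and A \ox Z: a tensor whose two legs
    commute with A is fixed by pi \ox id and by id \ox pi, where pi is a
    projection onto the center. *)
Lemma tensv_centerP (t : tens A A) :
  t \in tensv 'Z({:A})%VS 'Z({:A})%VS <->
  (forall h, \sw_(a, b <- t) ((a * h) \ox b) = \sw_(a, b <- t) ((h * a) \ox b)) /\
  (forall h, \sw_(a, b <- t) (a \ox (b * h)) = \sw_(a, b <- t) (a \ox (h * b))).
Proof.
split=> [tZ|[cl cr]].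
  split=> h; apply: (tensv_ind _ tZ) => a b /mem_center aZ /mem_center bZ /=.
    by rewrite !tlift_pure ?aZ //; bil.
  by rewrite !tlift_pure ?bZ //; bil.
suff <- : \sw_(a, b <- t)
    (projv 'Z({:A})%VS a \ox projv 'Z({:A})%VS b) = t.
  rewrite memv_suml // => i _; rewrite memv_suml // => j _.
  by rewrite memvZ // tpure_tensv ?memv_proj.
have El : \sw_(a, b <- t) (projv 'Z({:A})%VS a \ox b) = t.
  apply: tlift_projl => g; apply/mem_center => h.
  have := congr1 (tlift (fun a b => (g b : k) *: a)) (cl h).
  rewrite !tlift_sw => E.
  rewrite (linear_fun_tlift (f := fun a => a * h)); last by lin.
  rewrite (linear_fun_tlift (f := fun a => h * a)); last by lin.
  transitivity (\sw_(a, b <- t) tlift (fun a b => (g b : k) *: a) ((a * h) \ox b)).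
    by apply: eq_tlift => a b; rewrite tlift_pure ?scalerAl //; bil.
  rewrite E; apply: eq_tlift => a b.
  by rewrite tlift_pure ?scalerAr //; bil.
have Er : \sw_(a, b <- t) (a \ox projv 'Z({:A})%VS b) = t.
  apply: tlift_projr => f; apply/mem_center => h.
  have := congr1 (tlift (fun a b => (f a : k) *: b)) (cr h).
  rewrite !tlift_sw => E.
  rewrite (linear_fun_tlift (f := fun a => a * h)); last by lin.
  rewrite (linear_fun_tlift (f := fun a => h * a)); last by lin.
  transitivity (\sw_(a, b <- t) tlift (fun a b => (f a : k) *: b) (a \ox (b * h))).
    by apply: eq_tlift => a b; rewrite tlift_pure ?scalerAl //; bil.
  rewrite E; apply: eq_tlift => a b.
  by rewrite tlift_pure ?scalerAr //; bil.
rewrite -[RHS]El -[in RHS]Er tlift_sw; apply: eq_tlift => a b.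
by rewrite tlift_pure //; bil.
Qed.

End Center.

(** * The antipode *)

(* With these structures, [lin] applies to expressions built with [adj_act],
   [act] and [precomp]. *)
HB.instance Definition _ (k : fieldType) (H : hopfAlgebra k) :=
  GRing.isLinear.Build k H 'End(H) _ (@adj_act k H) (@adj_act_linear k H).
HB.instance Definition _ (k : fieldType) (A : falgType k) (V : lmodule A) :=
  GRing.isLinear.Build k A 'End(V) _ (@act k A V) (act_is_linear V).
HB.instance Definition _ (k : fieldType) (V W : vectType k) :=
  GRing.isLinear.Build k 'Hom(V, W) _ _ (@precomp k V W) (@precomp_linear k V W).

Section Antipode.
Context {k : fieldType} {H : hopfAlgebra k}.
Local Notation S := (@antipode k H).

Lemma antipodel_sw (U : lmodType k) (f : H -> U) h : linear f ->
  \sw_(a, b <- comul h) f (S a * b) = (counit h : k) *: f 1.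
Proof.
by move=> lf; rewrite -linear_funZ // -antipodel linear_fun_tlift.
Qed.

Lemma antipoder_sw (U : lmodType k) (f : H -> U) h : linear f ->
  \sw_(a, b <- comul h) f (a * S b) = (counit h : k) *: f 1.
Proof.
by move=> lf; rewrite -linear_funZ // -antipoder linear_fun_tlift.
Qed.

(** Delta \o S and (S \ox S) \o Delta^op are both inverse to Delta for convolution
    in Hom(H, H \ox H). *)
Lemma comul_antipode h : comul (S h) = \sw_(a, b <- comul h) (S b \ox S a).
Proof.
(* Both sides are equal to Delta(S h_(1)) (h_(2) S(h_(5)) \ox h_(3) S(h_(4))). *)
transitivity (\sw_(a, b <- comul h) \sw_(b1, b2 <- comul b)
    \sw_(c, d <- comul b1) \sw_(u, v <- comul b2) \sw_(x, y <- comul (S a))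
      ((x * (c * S v)) \ox (y * (d * S u)))).
  rewrite -[LHS](counitr_sw (f := fun h => comul (S h))); last by lin.
  apply: eq_tlift => a b; symmetry.
  rewrite (comulA (T := fun c d b2 => \sw_(u, v <- comul b2)
    \sw_(x, y <- comul (S a)) ((x * (c * S v)) \ox (y * (d * S u)))));
    [ | by move=> ? ?; lin.. ].
  transitivity (\sw_(c, v <- comul b) \sw_(x, y <- comul (S a))
      ((x * (c * S v)) \ox y)).
    apply: eq_tlift => c b'.
    rewrite -(comulA (T := fun d u v => \sw_(x, y <- comul (S a))
      ((x * (c * S v)) \ox (y * (d * S u))))); [ | by move=> ? ?; lin.. ].
    rewrite -[RHS](counitl_sw (f := fun v => \sw_(x, y <- comul (S a))
      ((x * (c * S v)) \ox y))); last by lin.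
    apply: eq_tlift => p v.
    rewrite (antipoder_sw (f := fun w => \sw_(x, y <- comul (S a))
      ((x * (c * S v)) \ox (y * w)))); last by lin.
    by congr (_ *: _); apply: eq_tlift => x y; rewrite mulr1.
  rewrite (antipoder_sw (f := fun w => \sw_(x, y <- comul (S a))
      ((x * w) \ox y))); last by lin.
  congr (_ *: _); rewrite -[RHS]tlift_id; apply: eq_tlift => x y.
  by rewrite mulr1.
rewrite -(comulA (T := fun a b1 b2 => \sw_(c, d <- comul b1)
    \sw_(u, v <- comul b2) \sw_(x, y <- comul (S a))
      ((x * (c * S v)) \ox (y * (d * S u))))); [ | by move=> ? ?; lin.. ].
rewrite -[RHS](counitl_sw (f := fun q => \sw_(u, v <- comul q) (S v \ox S u)));
  last by lin.
apply: eq_tlift => p q.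
transitivity (\sw_(a, b <- comul p) \sw_(x, y <- comul (S a * b))
   \sw_(u, v <- comul q) ((x * S v) \ox (y * S u))).
  apply: eq_tlift => a b; rewrite comulM_sw; last by bil.
  rewrite [RHS]exchange_tlift; apply: eq_tlift => c d.
  rewrite [LHS]exchange_tlift; apply: eq_tlift => x y.
  by apply: eq_tlift => u v; rewrite !mulrA.
rewrite (antipodel_sw (f := fun z => \sw_(x, y <- comul z)
   \sw_(u, v <- comul q) ((x * S v) \ox (y * S u)))); last by lin.
rewrite comul1 tlift_pure; last by bil.
by congr (_ *: _); apply: eq_tlift => u v; rewrite !mul1r.
Qed.

Lemma adj_act_one x : adj_act x (1 : H) = (counit x)%:A.
Proof. by rewrite adj_actE -antipoder; apply: eq_tlift => u v; rewrite mulr1. Qed.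

End Antipode.

(** * The universal R-matrix *)

Section RMatrix.
Context {k : fieldType} {H : hopfAlgebra k}.
Variable R : tens H H.
Hypothesis Rqt : quasi_triangular R.
Local Notation S := (@antipode k H).

Lemma comulR1 (U : lmodType k) (T : H -> H -> H -> U) :
  (forall y z, linear (fun x => T x y z)) ->
  (forall x z, linear (fun y => T x y z)) ->
  (forall x y, linear (fun z => T x y z)) ->
  \sw_(r1, r2 <- R) \sw_(a, b <- comul r1) T a b r2 =
  \sw_(r1, r2 <- R) \sw_(s1, s2 <- R) T r1 s1 (r2 * s2).
Proof.
move=> T1 T2 T3.
have := congr1 (tlift (fun x => tlift (T x))) (qt_comull Rqt); rewrite !tlift_sw.
under eq_tlift do rewrite tlift_sw.
under [in RHS]eq_tlift do rewrite tlift_sw.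
under eq_tlift => a b do (under eq_tlift do rewrite tlift3_pure //).
by under [in RHS]eq_tlift => a b do (under eq_tlift do rewrite tlift3_pure //).
Qed.

Lemma comulR2 (U : lmodType k) (T : H -> H -> H -> U) :
  (forall y z, linear (fun x => T x y z)) ->
  (forall x z, linear (fun y => T x y z)) ->
  (forall x y, linear (fun z => T x y z)) ->
  \sw_(r1, r2 <- R) \sw_(a, b <- comul r2) T r1 a b =
  \sw_(r1, r2 <- R) \sw_(s1, s2 <- R) T (r1 * s1) s2 r2.
Proof.
move=> T1 T2 T3.
have := congr1 (tlift (fun x => tlift (T x))) (qt_comulr Rqt); rewrite !tlift_sw.
under eq_tlift do rewrite tlift_sw.
under [in RHS]eq_tlift do rewrite tlift_sw.
under eq_tlift => a b do (under eq_tlift do rewrite tlift3_pure //).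
by under [in RHS]eq_tlift => a b do (under eq_tlift do rewrite tlift3_pure //).
Qed.

Lemma comul_R_sw (U : lmodType k) (F : H -> H -> U) h : bilin F ->
  \sw_(r1, r2 <- R) \sw_(a, b <- comul h) F (r1 * a) (r2 * b) =
  \sw_(r1, r2 <- R) \sw_(a, b <- comul h) F (b * r1) (a * r2).
Proof.
move=> bF; have := congr1 (tlift F) (qt_comul Rqt h).
rewrite !tlift_sw.
under eq_tlift => a b do rewrite tlift_sw.
under [in RHS]eq_tlift => a b do rewrite tlift_sw.
under eq_tlift => a b do (under eq_tlift do rewrite tlift_pure //).
by under [in RHS]eq_tlift => a b do (under eq_tlift do rewrite tlift_pure //).
Qed.

Lemma idem_rinv_eq1 (e e' : H) : e * e = e -> e * e' = 1 -> e = 1.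
Proof. by move=> ee ee'; rewrite -[LHS]mulr1 -ee' mulrA ee. Qed.

(** Applying the counit twice to (Delta \ox id) R shows that (epsilon \ox id) R
    is idempotent, and it is invertible as R is. *)
Lemma counitRl : \sw_(r1, r2 <- R) ((counit r1 : k) *: r2) = 1.
Proof.
set e := LHS.
have ee : e * e = e.
  have := comulR1 (T := fun x y z => (counit x : k) *: ((counit y : k) *: z)).
  move=> /(_ _ _ _) E; rewrite /e -[RHS]/e tlift_mull.
  under eq_tlift do rewrite tlift_mulr.
  symmetry; rewrite /e -[RHS]/(\sw_(r1, r2 <- R) \sw_(s1, s2 <- R) _).
  transitivity (\sw_(r1, r2 <- R) \sw_(a, b <- comul r1)
    ((counit a : k) *: ((counit b : k) *: r2))).
    apply: eq_tlift => a b.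
    by rewrite (counitl_sw (f := fun x => (counit x : k) *: b)) //; lin.
  rewrite E; try by move=> *; lin.
  by apply: eq_tlift => a b; apply: eq_tlift => c d; rewrite -scalerAl -scalerAr.
have [R' [RR' _]] := qt_invertible Rqt.
pose L := tlift (fun a b : H => (counit a : k) *: b).
have := congr1 L RR'; rewrite /L tlift_pure; last by bil.
rewrite counit1 scale1r /tens_mul tlift_sw => e1.
apply: (@idem_rinv_eq1 e (tlift (fun a b : H => (counit a : k) *: b) R')) => //.
rewrite -e1 /e tlift_mull; apply: eq_tlift => a b.
rewrite tlift_sw tlift_mulr; apply: eq_tlift => c d.
rewrite tlift_pure; last by bil.
by rewrite counitM -scalerA scalerAr scalerAl.
Qed.

Lemma counitRr : \sw_(r1, r2 <- R) ((counit r2 : k) *: r1) = 1.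
Proof.
set e := LHS.
have ee : e * e = e.
  have := comulR2 (T := fun x y z => (counit y : k) *: ((counit z : k) *: x)).
  move=> /(_ _ _ _) E; rewrite /e -[RHS]/e tlift_mull.
  under eq_tlift do rewrite tlift_mulr.
  symmetry; rewrite /e -[RHS]/(\sw_(r1, r2 <- R) \sw_(s1, s2 <- R) _).
  transitivity (\sw_(r1, r2 <- R) \sw_(a, b <- comul r2)
    ((counit a : k) *: ((counit b : k) *: r1))).
    apply: eq_tlift => a b.
    by rewrite (counitl_sw (f := fun x => (counit x : k) *: a)) //; lin.
  rewrite E; try by move=> *; lin.
  apply: eq_tlift => a b; apply: eq_tlift => c d.
  by rewrite -scalerAl -scalerAr !scalerA mulrC.
have [R' [RR' _]] := qt_invertible Rqt.
pose L := tlift (fun a b : H => (counit b : k) *: a).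
have := congr1 L RR'; rewrite /L tlift_pure; last by bil.
rewrite counit1 scale1r /tens_mul tlift_sw => e1.
apply: (@idem_rinv_eq1 e (tlift (fun a b : H => (counit b : k) *: a) R')) => //.
rewrite -e1 /e tlift_mull; apply: eq_tlift => a b.
rewrite tlift_sw tlift_mulr; apply: eq_tlift => c d.
rewrite tlift_pure; last by bil.
by rewrite counitM -scalerA scalerAr scalerAl.
Qed.

Lemma counitRl_sw (U : lmodType k) (f : H -> U) : linear f ->
  \sw_(r1, r2 <- R) ((counit r1 : k) *: f r2) = f 1.
Proof.
move=> lf; rewrite -counitRl linear_fun_tlift //.
by apply: eq_tlift => a b; rewrite linear_funZ.
Qed.

Lemma counitRr_sw (U : lmodType k) (f : H -> U) : linear f ->
  \sw_(r1, r2 <- R) ((counit r2 : k) *: f r1) = f 1.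
Proof.
move=> lf; rewrite -counitRr linear_fun_tlift //.
by apply: eq_tlift => a b; rewrite linear_funZ.
Qed.

(** R_1^1 S(R_2^1) \ox R_1^2 R_2^2 = R^1_(1) S(R^1_(2)) \ox R^2, so that
    (S \ox id) R is inverse to R. *)
Lemma R_mul_SR (U : lmodType k) (F : H -> H -> U) : bilin F ->
  \sw_(r1, r2 <- R) \sw_(s1, s2 <- R) F (r1 * S s1) (r2 * s2) = F 1 1.
Proof.
case=> Fl Fr.
rewrite -(comulR1 (T := fun a b c => F (a * S b) c)).
- rewrite -[RHS](counitRl_sw (f := F 1)) //; apply: eq_tlift => r1 r2.
  by rewrite (antipoder_sw (f := F^~ r2)).
- by move=> y z c u v; rewrite mulrDl -scalerAl Fl.
- by move=> y z c u v; rewrite linearP mulrDr -scalerAr Fl.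
- by [].
Qed.

Lemma SR_mul_R (U : lmodType k) (F : H -> H -> U) : bilin F ->
  \sw_(r1, r2 <- R) \sw_(s1, s2 <- R) F (S r1 * s1) (r2 * s2) = F 1 1.
Proof.
case=> Fl Fr.
rewrite -(comulR1 (T := fun a b c => F (S a * b) c)).
- rewrite -[RHS](counitRl_sw (f := F 1)) //; apply: eq_tlift => r1 r2.
  by rewrite (antipodel_sw (f := F^~ r2)).
- by move=> y z c u v; rewrite linearP mulrDl -scalerAl Fl.
- by move=> y z c u v; rewrite mulrDr -scalerAr Fl.
- by [].
Qed.

(** R_1^1 R_2^1 \ox S(R_2^2) R_1^2 = R^1 \ox S(R^2_(1)) R^2_(2), so that
    (id \ox S) R is inverse to R in H \ox H^op. *)
Lemma R_mulop_RS (U : lmodType k) (F : H -> H -> U) : bilin F ->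
  \sw_(r1, r2 <- R) \sw_(s1, s2 <- R) F (r1 * s1) (S s2 * r2) = F 1 1.
Proof.
case=> Fl Fr.
rewrite -(comulR2 (T := fun a b c => F a (S b * c))).
- rewrite -[RHS](counitRr_sw (f := F^~ 1)) //; apply: eq_tlift => r1 r2.
  by rewrite (antipodel_sw (f := F r1)).
- by [].
- by move=> y z c u v; rewrite linearP mulrDl -scalerAl Fr.
- by move=> y z c u v; rewrite mulrDr -scalerAr Fr.
Qed.

(** (S \ox S) R and R are both inverse to (S \ox id) R. *)
Lemma antipode_R (U : lmodType k) (F : H -> H -> U) : bilin F ->
  \sw_(r1, r2 <- R) F (S r1) (S r2) = \sw_(r1, r2 <- R) F r1 r2.
Proof.
move=> bF.
have E : \sw_(r1, r2 <- R) (S r1 \ox S r2) = R.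
  transitivity (\sw_(t1, t2 <- R) \sw_(r1, r2 <- R) \sw_(s1, s2 <- R)
      ((S (r1 * s1) * t1) \ox ((S s2 * r2) * t2))).
    transitivity (\sw_(s1, s2 <- R) \sw_(r1, r2 <- R) \sw_(t1, t2 <- R)
      ((S s1 * (S r1 * t1)) \ox (S s2 * (r2 * t2)))).
      apply: eq_tlift => s1 s2.
      rewrite (SR_mul_R (F := fun x y => (S s1 * x) \ox (S s2 * y)));
        last by bil.
      by rewrite !mulr1.
    under eq_tlift do rewrite exchange_tlift.
    rewrite exchange_tlift; apply: eq_tlift => t1 t2; rewrite exchange_tlift.
    apply: eq_tlift => r1 r2; apply: eq_tlift => s1 s2.
    by rewrite antipodeM !mulrA.
  rewrite -[RHS]tlift_id; apply: eq_tlift => t1 t2.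
  rewrite (R_mulop_RS (F := fun x y => (S x * t1) \ox (y * t2))); last by bil.
  by rewrite antipode1 !mul1r.
by rewrite -[in RHS]E tlift_sw; apply: eq_tlift => a b; rewrite tlift_pure.
Qed.

(** The Drinfeld element u = S(R^2) R^1 satisfies u h = S(S(h)) u and is
    left invertible, hence S(h) = 0 implies u h = 0 and h = 0. *)
Lemma antipode_inj : injective S.
Proof.
pose u := \sw_(r1, r2 <- R) (S r2 * r1).
(* u h = S(S(h_(3))) S(R^2 h_(2)) R^1 h_(1), in which R can be moved across
   h_(1) \ox h_(2). *)
have uS h : u * h = S (S h) * u.
  transitivity (\sw_(p, c <- comul h) \sw_(a, b <- comul p)
      \sw_(r1, r2 <- R) (S (S c) * S (r2 * b) * (r1 * a))).
    rewrite (comulA (T := fun a b c => \sw_(r1, r2 <- R)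
      (S (S c) * S (r2 * b) * (r1 * a)))); [ | by move=> ? ?; lin.. ].
    rewrite -[LHS](counitr_sw (f := fun x => u * x)); last by lin.
    apply: eq_tlift => a b.
    transitivity (\sw_(b1, b2 <- comul b) \sw_(r1, r2 <- R)
       (S (b1 * S b2) * (S r2 * (r1 * a)))); last first.
      apply: eq_tlift => b1 b2; apply: eq_tlift => r1 r2.
      by rewrite !antipodeM !mulrA.
    rewrite (antipoder_sw (f := fun x => \sw_(r1, r2 <- R)
       (S x * (S r2 * (r1 * a))))); last by lin.
    congr (_ *: _); rewrite /u tlift_mull; apply: eq_tlift => r1 r2.
    by rewrite antipode1 mul1r !mulrA.
  rewrite -[RHS](counitl_sw (f := fun x => S (S x) * u)); last by lin.
  apply: eq_tlift => p c; rewrite exchange_tlift.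
  rewrite (comul_R_sw (F := fun x y => S (S c) * S y * x)); last by bil.
  rewrite /u tlift_mulr scaler_tlift; apply: eq_tlift => r1 r2.
  transitivity (\sw_(a, b <- comul p) (S (S c) * (S r2 * ((S a * b) * r1)))).
    by apply: eq_tlift => a b; rewrite !antipodeM !mulrA.
  rewrite (antipodel_sw (f := fun x => S (S c) * (S r2 * (x * r1))));
    last by lin.
  by rewrite mul1r.
(* For v = R^2 S(S(R^1)), moving u across S(S(R^1)) gives v u = R^2 u R^1. *)
have [v vu] : exists v, v * u = 1.
  exists (\sw_(r1, r2 <- R) (r2 * S (S r1))).
  rewrite tlift_mull.
  under eq_tlift do rewrite -mulrA -uS /u mulrA tlift_mulr tlift_mull.
  transitivity (\sw_(r1, r2 <- R) \sw_(s1, s2 <- R) (S (s2 * r2) * (s1 * S r1))).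
    rewrite -(antipode_R (F := fun r1 r2 => \sw_(s1, s2 <- R)
      (r2 * (S s2 * s1) * r1))); last by bil.
    by apply: eq_tlift => r1 r2; apply: eq_tlift => s1 s2;
      rewrite antipodeM !mulrA.
  rewrite exchange_tlift (R_mul_SR (F := fun x y => S y * x)); last by bil.
  by rewrite antipode1 mulr1.
move=> x y Sxy; have : u * x = u * y by rewrite !uS Sxy.
by move/(congr1 ( *%R v)); rewrite !mulrA vu !mul1r.
Qed.

Lemma adj_R1 (U : lmodType k) (F : H -> H -> U) x : bilin F ->
  \sw_(r1, r2 <- R) F (adj_act r1 x) r2 =
  \sw_(r1, r2 <- R) \sw_(s1, s2 <- R) F (r1 * x * S s1) (r2 * s2).
Proof.
case=> Fl Fr.
rewrite -(comulR1 (T := fun a b c => F (a * x * S b) c)).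
- apply: eq_tlift => r1 r2; rewrite adj_actE.
  exact: (linear_fun_tlift (f := F^~ r2)).
- by move=> y z c u v; rewrite !mulrDl -!scalerAl Fl.
- by move=> y z c u v; rewrite linearP mulrDr -scalerAr Fl.
- by [].
Qed.

Lemma adj_R2 (U : lmodType k) (F : H -> H -> U) x : bilin F ->
  \sw_(r1, r2 <- R) F r1 (adj_act r2 x) =
  \sw_(r1, r2 <- R) \sw_(s1, s2 <- R) F (r1 * s1) (s2 * x * S r2).
Proof.
case=> Fl Fr.
rewrite -(comulR2 (T := fun a b c => F a (b * x * S c))).
- apply: eq_tlift => r1 r2; rewrite adj_actE.
  exact: (linear_fun_tlift (f := F r1)).
- by [].
- by move=> y z c u v; rewrite !mulrDl -!scalerAl Fr.
- by move=> y z c u v; rewrite linearP mulrDr -scalerAr Fr.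
Qed.

End RMatrix.

(** * Cocommutativity of the transmuted coproduct *)

Section Cocommutativity.
Context {k : fieldType} {H : hopfAlgebra k}.
Variable R : tens H H.
Hypothesis Rqt : quasi_triangular R.
Local Notation S := (@antipode k H).
Local Notation braidH := (@braid k H R (adj_lmodule H) (adj_lmodule H)).

(** With R_i the copies of R,
      h_(1) S(R^2) \ox R^1.h_(2)
        = h_(1) S(R_2^2) S(R_1^2) \ox R_1^1 h_(2) S(R_2^1)
        = h_(1) R_2^2 S(R_1^2) \ox R_1^1 h_(2) R_2^1
        = R_2^2 h_(2) S(R_1^2) \ox R_1^1 R_2^1 h_(1)
        = R^2.h_(2) \ox R^1 h_(1),
    by (S \ox S) R = R, the quasi-cocommutativity of H, and the formula for
    (id \ox Delta) R. *)
Lemma transmuted_comulE h : transmuted_comul R h =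
  \sw_(a, b <- comul h) \sw_(r1, r2 <- R) (adj_act r2 b \ox (r1 * a)).
Proof.
rewrite /transmuted_comul.
transitivity (\sw_(r1, r2 <- R) \sw_(s1, s2 <- R) \sw_(a, b <- comul h)
   ((a * s2 * S r2) \ox (r1 * (b * s1)))).
  under [RHS]eq_tlift do rewrite exchange_tlift.
  rewrite [RHS]exchange_tlift; apply: eq_tlift => a b.
  rewrite (adj_R1 Rqt (F := fun x y => (a * S y) \ox x)); last by bil.
  apply: eq_tlift => r1 r2.
  rewrite -(antipode_R Rqt (F := fun s1 s2 => (a * s2 * S r2) \ox (r1 * (b * s1))));
    last by bil.
  by apply: eq_tlift => s1 s2; rewrite antipodeM !mulrA.
transitivity (\sw_(r1, r2 <- R) \sw_(s1, s2 <- R) \sw_(a, b <- comul h)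
   ((s2 * b * S r2) \ox (r1 * (s1 * a)))).
  apply: eq_tlift => r1 r2.
  by rewrite (comul_R_sw Rqt (F := fun x y => (y * S r2) \ox (r1 * x))) //; bil.
under [LHS]eq_tlift do rewrite exchange_tlift.
rewrite [LHS]exchange_tlift; apply: eq_tlift => a b.
rewrite (adj_R2 Rqt (F := fun x y => y \ox (x * a))); last by bil.
by apply: eq_tlift => r1 r2; apply: eq_tlift => s1 s2; rewrite !mulrA.
Qed.

Lemma braid_pure (V W : lmodule H) v w :
  @braid k H R V W (v \ox w) = \sw_(r1, r2 <- R) (act r2 w \ox act r1 v).
Proof. by rewrite /braid tlift_pure //; bil. Qed.

Lemma braid_tlift (V W : lmodule H) (V' W' : vectType k)
   (F : V' -> W' -> tens V W) t :
  braid R (\sw_(a, b <- t) F a b) = \sw_(a, b <- t) braid R (F a b).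
Proof. exact: tlift_sw. Qed.

(** By the formula for (Delta \ox id) R,
      R_2^2.(R_1^1.h_(2)) \ox R_2^1.(h_(1) S(R_1^2))
        = R_2^2.(R_3^2.(R_1^1.h_(2))) \ox R_2^1 h_(1) S(R_1^2) S(R_3^1),
    and R_3^2 R_1^1 \ox R_3^1 R_1^2 is R^{21} R. *)
Lemma braid_transmuted_comul h : braidH (transmuted_comul R h) =
  \sw_(a, b <- comul h) \sw_(u1, u2 <- R) \sw_(r1, r2 <- R) \sw_(s1, s2 <- R)
    (adj_act u2 (adj_act (s2 * r1) b) \ox (u1 * a * S (s1 * r2))).
Proof.
rewrite /transmuted_comul braid_tlift; apply: eq_tlift => a b.
rewrite braid_tlift [RHS]exchange_tlift; apply: eq_tlift => r1 r2.
rewrite braid_pure /= (adj_R1 Rqt (F := fun x y => adj_act y (adj_act r1 b) \ox x));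
  last by bil.
apply: eq_tlift => u1 u2; apply: eq_tlift => s1 s2.
by rewrite antipodeM -!adj_actM !mulrA.
Qed.

Definition monodromy_trivial := forall h : H,
  \sw_(r1, r2 <- R) \sw_(s1, s2 <- R) (adj_act (s2 * r1) h \ox (s1 * r2)) =
  h \ox (1 : H).

Definition transmuted_cocomm := forall h : H,
  braidH (transmuted_comul R h) = transmuted_comul R h.

Lemma monodromy_trivial_sw (U : lmodType k) (F : H -> H -> U) h :
  monodromy_trivial -> bilin F ->
  \sw_(r1, r2 <- R) \sw_(s1, s2 <- R) F (adj_act (s2 * r1) h) (s1 * r2) = F h 1.
Proof.
move=> tm bF; have := congr1 (tlift F) (tm h).
rewrite tlift_sw tlift_pure // => <-; apply: eq_tlift => a b.
by rewrite tlift_sw; apply: eq_tlift => c d; rewrite tlift_pure.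
Qed.

Lemma cocomm_of_monodromy : monodromy_trivial -> transmuted_cocomm.
Proof.
move=> tm h; rewrite braid_transmuted_comul transmuted_comulE.
apply: eq_tlift => a b; apply: eq_tlift => u1 u2.
rewrite (monodromy_trivial_sw (F := fun x y => adj_act u2 x \ox (u1 * a * S y)))
  //; last by bil.
by rewrite antipode1 mulr1.
Qed.

(** A left inverse is obtained from (S \ox id) R = R^-1 in the same way. *)
Lemma act_R_inj (t t' : tens H H) :
  \sw_(x, y <- t) \sw_(r1, r2 <- R) (adj_act r2 x \ox (r1 * y)) =
  \sw_(x, y <- t') \sw_(r1, r2 <- R) (adj_act r2 x \ox (r1 * y)) -> t = t'.
Proof.
pose L := tlift (fun x y : H =>
  \sw_(r1, r2 <- R) (adj_act r2 x \ox (S r1 * y))).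
suff K s : L (\sw_(x, y <- s) \sw_(r1, r2 <- R) (adj_act r2 x \ox (r1 * y))) = s.
  by move/(congr1 L); rewrite !K.
rewrite /L tlift_sw -[RHS]tlift_id; apply: eq_tlift => x y.
transitivity (\sw_(r1, r2 <- R) \sw_(s1, s2 <- R)
   (adj_act (r2 * s2) x \ox (S r1 * s1 * y))); last first.
  rewrite (SR_mul_R Rqt (F := fun a b => adj_act b x \ox (a * y))); last by bil.
  by rewrite adj_act1 mul1r.
rewrite tlift_sw exchange_tlift; apply: eq_tlift => r1 r2.
rewrite tlift_pure; last by bil.
by apply: eq_tlift => s1 s2; rewrite adj_actM mulrA.
Qed.

Lemma tens_antipode_inj (V : vectType k) (t t' : tens V H) :
  \sw_(x, y <- t) (x \ox S y) = \sw_(x, y <- t') (x \ox S y) -> t = t'.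
Proof.
pose f : 'End(H) := linfun S.
have fK : cancel f f^-1%VF.
  apply: lker0_lfunK; apply/lker0P=> x y; rewrite !lfunE.
  exact: (antipode_inj Rqt).
pose L := tlift (fun (x : V) y => x \ox f^-1%VF y).
suff K s : L (\sw_(x, y <- s) (x \ox S y)) = s by move/(congr1 L); rewrite !K.
rewrite /L tlift_sw -[RHS]tlift_id; apply: eq_tlift => x y.
by rewrite tlift_pure; [rewrite -{2}(fK y) lfunE | bil].
Qed.

(** By [braid_transmuted_comul] and [transmuted_comulE], the two sides of
    cocommutativity are the images of Q^1.h_(2) \ox h_(1) S(Q^2) and of
    h_(2) \ox h_(1) under the injective map of [act_R_inj]. *)
Lemma monodromy_of_cocomm : transmuted_cocomm -> monodromy_trivial.
Proof.
move=> co h.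
have E g : \sw_(a, b <- comul g) \sw_(r1, r2 <- R) \sw_(s1, s2 <- R)
     (adj_act (s2 * r1) b \ox (a * S (s1 * r2))) =
   \sw_(a, b <- comul g) (b \ox a).
  apply: act_R_inj.
  rewrite !tlift_sw; have := co g.
  rewrite braid_transmuted_comul transmuted_comulE => E.
  transitivity (\sw_(a, b <- comul g) \sw_(u1, u2 <- R) \sw_(r1, r2 <- R)
      \sw_(s1, s2 <- R)
    (adj_act u2 (adj_act (s2 * r1) b) \ox (u1 * a * S (s1 * r2)))).
    apply: eq_tlift => a b; rewrite tlift_sw [RHS]exchange_tlift.
    apply: eq_tlift => r1 r2; rewrite tlift_sw [RHS]exchange_tlift.
    apply: eq_tlift => s1 s2; rewrite tlift_pure; last by bil.
    by apply: eq_tlift => u1 u2; rewrite mulrA.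
  by rewrite E; apply: eq_tlift => a b; rewrite tlift_pure //; bil.
apply: tens_antipode_inj.
(* [E] is applied to the second leg of h_(1) \ox h_(2), and h_(1) is cancelled
   by multiplication with S(h_(1)). *)
rewrite tlift_pure ?antipode1; last by bil.
transitivity (\sw_(p, g <- comul h) tlift (fun x y => x \ox (S p * y))
   (\sw_(a, b <- comul g) \sw_(r1, r2 <- R) \sw_(s1, s2 <- R)
     (adj_act (s2 * r1) b \ox (a * S (s1 * r2))))).
  transitivity (\sw_(p, g <- comul h) \sw_(a, b <- comul g)
     \sw_(r1, r2 <- R) \sw_(s1, s2 <- R)
       (adj_act (s2 * r1) b \ox (S p * a * S (s1 * r2)))).
    rewrite -(comulA (T := fun p a b => \sw_(r1, r2 <- R) \sw_(s1, s2 <- R)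
       (adj_act (s2 * r1) b \ox (S p * a * S (s1 * r2)))));
      [ | by move=> ? ?; lin.. ].
    rewrite tlift_sw.
    under [LHS]eq_tlift do rewrite tlift_sw.
    rewrite -[LHS](counitl_sw (f := fun h => \sw_(r1, r2 <- R) \sw_(s1, s2 <- R)
       tlift (fun x y => x \ox S y) (adj_act (s2 * r1) h \ox (s1 * r2))));
      last by lin.
    apply: eq_tlift => p b.
    rewrite (antipodel_sw (f := fun x => \sw_(r1, r2 <- R) \sw_(s1, s2 <- R)
       (adj_act (s2 * r1) b \ox (x * S (s1 * r2))))); last by lin.
    congr (_ *: _); apply: eq_tlift => r1 r2; apply: eq_tlift => s1 s2.
    by rewrite mul1r tlift_pure //; bil.
  apply: eq_tlift => p g.
  rewrite tlift_sw; apply: eq_tlift => a b.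
  rewrite tlift_sw; apply: eq_tlift => r1 r2.
  rewrite tlift_sw; apply: eq_tlift => s1 s2.
  by rewrite tlift_pure ?mulrA //; bil.
under eq_tlift do rewrite E tlift_sw.
transitivity (\sw_(p, g <- comul h) \sw_(a, b <- comul g) (b \ox (S p * a))).
  apply: eq_tlift => p g; apply: eq_tlift => a b.
  by rewrite tlift_pure //; bil.
rewrite -(comulA (T := fun p a b => b \ox (S p * a)));
  [ | by move=> ? ?; lin.. ].
rewrite -[RHS](counitl_sw (f := fun h => h \ox 1)); last by lin.
apply: eq_tlift => p b.
by rewrite (antipodel_sw (f := fun x => b \ox x)) //; lin.
Qed.

End Cocommutativity.

(** * Centrality of the monodromy element *)

Section Monodromy.
Context {k : fieldType} {H : hopfAlgebra k}.
Variable R : tens H H.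
Hypothesis Rqt : quasi_triangular R.
Local Notation S := (@antipode k H).

Definition monodromy : tens H H := tens_mul (tflip R) R.

Lemma monodromyE (U : lmodType k) (F : H -> H -> U) : bilin F ->
  \sw_(a, b <- monodromy) F a b =
  \sw_(r1, r2 <- R) \sw_(s1, s2 <- R) F (s2 * r1) (s1 * r2).
Proof.
move=> bF; rewrite /monodromy /tens_mul /tflip !tlift_sw [RHS]exchange_tlift.
apply: eq_tlift => s1 s2; rewrite tlift_pure; last by bil.
by rewrite tlift_sw; apply: eq_tlift => r1 r2; rewrite tlift_pure.
Qed.

Lemma monodromy_trivialE : monodromy_trivial R <->
  forall h : H, \sw_(a, b <- monodromy) (adj_act a h \ox b) = h \ox (1 : H).
Proof. by split=> E g; move: (E g); rewrite monodromyE //; bil. Qed.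

(** R intertwines Delta with the opposite coproduct and R^{21} the opposite
    coproduct with Delta. *)
Lemma monodromy_comul (U : lmodType k) (F : H -> H -> U) h : bilin F ->
  \sw_(a, b <- monodromy) \sw_(x, y <- comul h) F (a * x) (b * y) =
  \sw_(a, b <- monodromy) \sw_(x, y <- comul h) F (x * a) (y * b).
Proof.
case=> Fl Fr.
have bF : bilin (fun a b => \sw_(x, y <- comul h) F (a * x) (b * y)).
  split=> u; apply: lin_tlift => x y c v w; rewrite mulrDl -scalerAl ?Fl ?Fr //.
have bF' : bilin (fun a b => \sw_(x, y <- comul h) F (x * a) (y * b)).
  split=> u; apply: lin_tlift => x y c v w; rewrite mulrDr -scalerAr ?Fl ?Fr //.
rewrite !monodromyE //.
transitivity (\sw_(r1, r2 <- R) \sw_(s1, s2 <- R) \sw_(x, y <- comul h)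
   F (s2 * (y * r1)) (s1 * (x * r2))).
  rewrite [LHS]exchange_tlift [RHS]exchange_tlift; apply: eq_tlift => s1 s2.
  rewrite -(comul_R_sw Rqt (F := fun r1 r2 => F (s2 * r1) (s1 * r2))).
    by apply: eq_tlift => r1 r2; apply: eq_tlift => x y; rewrite !mulrA.
  by split=> u c v w; rewrite mulrDr -scalerAr ?Fl ?Fr.
apply: eq_tlift => r1 r2.
transitivity (\sw_(s1, s2 <- R) \sw_(x, y <- comul h)
   F ((s2 * y) * r1) ((s1 * x) * r2)).
  by apply: eq_tlift => s1 s2; apply: eq_tlift => x y; rewrite !mulrA.
rewrite (comul_R_sw Rqt (F := fun s1 s2 => F (s2 * r1) (s1 * r2))).
  by apply: eq_tlift => s1 s2; apply: eq_tlift => x y; rewrite !mulrA.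
by split=> u c v w; rewrite mulrDl -scalerAl ?Fl ?Fr.
Qed.

Definition monodromy_centl := forall h,
  \sw_(a, b <- monodromy) ((a * h) \ox b) = \sw_(a, b <- monodromy) ((h * a) \ox b).

Lemma monodromy_centl_sw (U : lmodType k) (F : H -> H -> U) h : bilin F ->
  monodromy_centl ->
  \sw_(a, b <- monodromy) F (a * h) b = \sw_(a, b <- monodromy) F (h * a) b.
Proof.
move=> bF c; have := congr1 (tlift F) (c h); rewrite tlift_sw [RHS]tlift_sw => E.
transitivity (\sw_(a, b <- monodromy) tlift F ((a * h) \ox b)).
  by apply: eq_tlift => a b; rewrite tlift_pure.
by rewrite E; apply: eq_tlift => a b; rewrite tlift_pure.
Qed.

(** If Q^1 is central then Delta(h) Q = Q Delta(h) reads
    Q^1 h_(1) \ox [h_(2), Q^2] = 0, and h_(1) can be cancelled. *)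
Lemma monodromy_centl_centr : monodromy_centl -> forall h,
  \sw_(a, b <- monodromy) (a \ox (b * h)) = \sw_(a, b <- monodromy) (a \ox (h * b)).
Proof.
move=> cl h.
transitivity (\sw_(p, g <- comul h) \sw_(a, b <- monodromy)
   \sw_(x, y <- comul g) ((S p * (a * x)) \ox (b * y))).
  transitivity (\sw_(p, g <- comul h) \sw_(x, y <- comul g)
     \sw_(a, b <- monodromy) ((a * (S p * x)) \ox (b * y))).
    rewrite -(comulA (T := fun p x y => \sw_(a, b <- monodromy)
      ((a * (S p * x)) \ox (b * y)))); [ | by move=> ? ?; lin.. ].
    rewrite -[LHS](counitl_sw (f := fun h => \sw_(a, b <- monodromy)
      (a \ox (b * h)))); last by lin.
    apply: eq_tlift => p y.
    rewrite (antipodel_sw (f := fun z => \sw_(a, b <- monodromy)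
      ((a * z) \ox (b * y)))); last by lin.
    by congr (_ *: _); apply: eq_tlift => a b; rewrite mulr1.
  apply: eq_tlift => p g; rewrite [RHS]exchange_tlift; apply: eq_tlift => x y.
  rewrite (monodromy_centl_sw (F := fun a b => a \ox (b * y))) //; last by bil.
  transitivity (\sw_(a, b <- monodromy) ((S p * (x * a)) \ox (b * y))).
    by apply: eq_tlift => a b; rewrite mulrA.
  by rewrite -(monodromy_centl_sw (F := fun a b => (S p * a) \ox (b * y))) //; bil.
transitivity (\sw_(p, g <- comul h) \sw_(a, b <- monodromy)
   \sw_(x, y <- comul g) ((S p * (x * a)) \ox (y * b))).
  apply: eq_tlift => p g.
  by rewrite (monodromy_comul (F := fun a b => (S p * a) \ox b)) //; bil.
under [LHS]eq_tlift do rewrite exchange_tlift.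
rewrite -(comulA (T := fun p x y => \sw_(a, b <- monodromy)
  ((S p * (x * a)) \ox (y * b)))); [ | by move=> ? ?; lin.. ].
rewrite -[RHS](counitl_sw (f := fun h => \sw_(a, b <- monodromy)
  (a \ox (h * b)))); last by lin.
apply: eq_tlift => p y.
rewrite -[X in _ = _ *: X](_ : \sw_(a, b <- monodromy) ((1 * a) \ox (y * b)) = _).
  rewrite -(antipodel_sw (f := fun z => \sw_(a, b <- monodromy)
    ((z * a) \ox (y * b)))); last by lin.
  by apply: eq_tlift => u v; apply: eq_tlift => a b; rewrite mulrA.
by apply: eq_tlift => a b; rewrite mul1r.
Qed.

Lemma almost_triangularE : almost_triangular R <-> monodromy_centl.
Proof.
split=> [/tensv_centerP[]// | c]; apply/tensv_centerP; split=> //.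
exact: monodromy_centl_centr.
Qed.

(** (Delta \ox id) Q = R_{32} Q_{13} R_{23}. *)
Lemma adj_monodromy (U : lmodType k) (F : H -> H -> U) h : bilin F ->
  \sw_(a, b <- monodromy) F (adj_act a h) b =
  \sw_(r1, r2 <- R) \sw_(s1, s2 <- R) \sw_(a, b <- monodromy)
    F (a * h * S s1 * S r2) (r1 * b * s2).
Proof.
case=> Fl Fr.
rewrite monodromyE; last first.
  by split=> ? c u v; rewrite ?linearP ?add_lfunE ?scale_lfunE ?Fl ?Fr.
under [RHS]eq_tlift => r1 r2.
  under eq_tlift => s1 s2.
    rewrite monodromyE; last first.
      by split=> u c v w; rewrite ?mulrDl ?mulrDr -?scalerAl -?scalerAr
        ?mulrDl -?scalerAl ?mulrDl -?scalerAl ?Fl ?Fr.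
    over.
  rewrite exchange_tlift.
  over.
rewrite [LHS]exchange_tlift.
transitivity (\sw_(t1, t2 <- R) \sw_(r1, r2 <- R) \sw_(s1, s2 <- R)
   F (adj_act t2 (r1 * h * S s1)) (t1 * (r2 * s2))).
  apply: eq_tlift => t1 t2.
  rewrite -(adj_R1 Rqt (F := fun x y => F (adj_act t2 x) (t1 * y))).
    by apply: eq_tlift => r1 r2; rewrite adj_actM.
  by split=> u c v w; rewrite ?linearP ?mulrDr -?scalerAr ?Fl ?Fr.
rewrite [LHS]exchange_tlift [RHS]exchange_tlift; apply: eq_tlift => r1 r2.
rewrite [LHS]exchange_tlift [RHS]exchange_tlift; apply: eq_tlift => s1 s2.
rewrite (adj_R2 Rqt (F := fun x y => F y (x * (r2 * s2)))).
  by apply: eq_tlift => t1 t2; apply: eq_tlift => u1 u2; rewrite !mulrA.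
by split=> u c v w; rewrite ?mulrDl -?scalerAl ?Fl ?Fr.
Qed.

End Monodromy.

Section TrivialMonodromy.
Context {k : fieldType} {H : hopfAlgebra k}.
Variable R : tens H H.
Hypothesis Rqt : quasi_triangular R.
Local Notation S := (@antipode k H).

Lemma counit_monodromy (U : lmodType k) (f : H -> U) : linear f ->
  \sw_(a, b <- monodromy R) ((counit a : k) *: f b) = f 1.
Proof.
move=> lf; rewrite monodromyE; last first.
  by split=> ? c x y; rewrite ?lf ?scalerDr ?linearP ?scalerDl ?scalerA // mulrC.
rewrite exchange_tlift -[RHS](counitRr_sw Rqt) //; apply: eq_tlift => s1 s2.
rewrite -[X in _ = _ *: f X]mulr1.
rewrite -(counitRl_sw Rqt (f := fun x => f (s1 * x))); last first.
  by move=> c x y; rewrite mulrDr -scalerAr lf.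
by rewrite scaler_tlift; apply: eq_tlift => r1 r2; rewrite counitM -scalerA.
Qed.

(** In Q^1 h S(R_1^1) S(R_2^2) \ox R_2^1 Q^2 R_1^2 the factor h can be moved to
    the left, and what remains is the same expression for h = 1. *)
Lemma monodromy_trivial_of_centl : monodromy_centl R -> monodromy_trivial R.
Proof.
move=> c; apply/monodromy_trivialE => h.
rewrite (adj_monodromy Rqt (F := fun x y => x \ox y)); last by bil.
transitivity (\sw_(r1, r2 <- R) \sw_(s1, s2 <- R) \sw_(a, b <- monodromy R)
    ((h * (a * 1 * S s1 * S r2)) \ox (r1 * b * s2))).
  apply: eq_tlift => r1 r2; apply: eq_tlift => s1 s2.
  rewrite (monodromy_centl_sw
    (F := fun a b => (a * S s1 * S r2) \ox (r1 * b * s2))) //; last by bil.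
  by apply: eq_tlift => a b; rewrite mulr1 !mulrA.
rewrite -(adj_monodromy Rqt (F := fun x y => (h * x) \ox y) 1); last by bil.
rewrite -[RHS](counit_monodromy (f := fun b => h \ox b)); last by lin.
apply: eq_tlift => a b; rewrite adj_act_one -scalerAr mulr1.
exact: tpureZl.
Qed.

(** The copies of R in Q^1 h S(R_1^1) S(R_2^2) \ox R_2^1 Q^2 R_1^2 = h \ox 1 are
    cancelled by R itself, as it is inverse to (S \ox id) R in H \ox H and to
    (id \ox S) R in H \ox H^op; the right-hand side becomes h Q^1 \ox Q^2. *)
Lemma centl_of_monodromy_trivial : monodromy_trivial R -> monodromy_centl R.
Proof.
move=> tm h.
have := (monodromy_trivialE R).1 tm h.
rewrite (adj_monodromy Rqt (F := fun x y => x \ox y)); last by bil.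
pose L := tlift (fun x y : H => \sw_(u1, u2 <- R) \sw_(v1, v2 <- R)
   ((x * u2 * v1) \ox (u1 * y * v2))).
move=> /(congr1 L); rewrite /L [X in _ = X -> _]tlift_pure; last by bil.
have -> : \sw_(u1, u2 <- R) \sw_(v1, v2 <- R) ((h * u2 * v1) \ox (u1 * 1 * v2))
   = \sw_(a, b <- monodromy R) ((h * a) \ox b).
  rewrite monodromyE; last by bil.
  rewrite exchange_tlift; apply: eq_tlift => v1 v2; apply: eq_tlift => u1 u2.
  by rewrite mulrA mulr1.
move=> <-; rewrite tlift_sw.
under [RHS]eq_tlift => r1 r2.
  rewrite tlift_sw; under eq_tlift => s1 s2.
    rewrite tlift_sw; under eq_tlift => a b do [rewrite tlift_pure; last by bil].
    rewrite exchange_tlift; under eq_tlift do rewrite exchange_tlift.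
    over.
  rewrite exchange_tlift.
  over.
rewrite exchange_tlift.
symmetry.
transitivity (\sw_(u1, u2 <- R) \sw_(r1, r2 <- R) \sw_(s1, s2 <- R)
  \sw_(v1, v2 <- R) \sw_(a, b <- monodromy R)
   ((a * h * (S s1 * (S r2 * u2) * v1)) \ox ((u1 * r1) * b * (s2 * v2)))).
  apply: eq_tlift => u1 u2; apply: eq_tlift => r1 r2; apply: eq_tlift => s1 s2.
  apply: eq_tlift => v1 v2; apply: eq_tlift => a b.
  by rewrite !mulrA.
rewrite (R_mulop_RS Rqt (F := fun x y => \sw_(s1, s2 <- R)
  \sw_(v1, v2 <- R) \sw_(a, b <- monodromy R)
   ((a * h * (S s1 * y * v1)) \ox (x * b * (s2 * v2))))); last by bil.
transitivity (\sw_(s1, s2 <- R)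
  \sw_(v1, v2 <- R) \sw_(a, b <- monodromy R)
   ((a * h * (S s1 * v1)) \ox (b * (s2 * v2)))).
  apply: eq_tlift => s1 s2.
  apply: eq_tlift => v1 v2; apply: eq_tlift => a b.
  by rewrite mulr1 mul1r.
rewrite (SR_mul_R Rqt (F := fun x y => \sw_(a, b <- monodromy R)
   ((a * h * x) \ox (b * y)))); last by bil.
by apply: eq_tlift => a b; rewrite !mulr1.
Qed.

End TrivialMonodromy.

(** * The Mueger center and quantum commutativity *)

Section MuegerAndDual.
Context {k : fieldType} {H : hopfAlgebra k}.

Fact reg_act_linear : linear (@amull k H).
Proof. exact: linearP. Qed.
Fact reg_act1 (v : H) : amull 1 v = v.
Proof. by rewrite lfunE /= mul1r. Qed.
Fact reg_actM (a b v : H) : amull (a * b) v = amull a (amull b v).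
Proof. by rewrite !lfunE /= mulrA. Qed.
Definition reg_lmodule : lmodule H := LModule reg_act_linear reg_act1 reg_actM.

Lemma reg_actE (a x : H) : @act k H reg_lmodule a x = a * x.
Proof. exact: lfunE. Qed.

Variable R : tens H H.

(** The square of the braiding of (H, ad) with X maps h \ox x to
    Q^1.h \ox Q^2 x; for X = H and x = 1 this is Q^1.h \ox Q^2. *)
Lemma monodromy_trivial_muger :
  monodromy_trivial R <-> in_muger_center R (adj_lmodule H).
Proof.
have ms (X : lmodule H) (v : adj_lmodule H) (x : X) :
    braid R (@braid k H R (adj_lmodule H) X (v \ox x)) =
    \sw_(r1, r2 <- R) \sw_(s1, s2 <- R)
       ((adj_act (s2 * r1) v : adj_lmodule H) \ox act (s1 * r2) x).
  rewrite braid_pure braid_tlift; apply: eq_tlift => r1 r2.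
  by rewrite braid_pure; apply: eq_tlift => s1 s2; rewrite actM adj_actM.
split=> [tm X t | mc h].
  rewrite -[RHS]tlift_id -{1}(tlift_id t) !braid_tlift; apply: eq_tlift => v x.
  rewrite ms (monodromy_trivial_sw (F := fun a b => a \ox act b x)) ?act1 //.
  by bil.
have := mc reg_lmodule (h \ox (1 : H)); rewrite ms => E.
rewrite -[RHS]E; apply: eq_tlift => r1 r2; apply: eq_tlift => s1 s2.
by rewrite reg_actE mulr1.
Qed.

(** For (H^op, R^{21}) the right-hand side of quantum commutativity at f and g
    is the form (f \ox g) \o sigma \o Delta_R: the exchange of the two legs of R
    together with the exchange of f and g is the braiding. *)
Lemma quantum_commutative_cocomm :
  @quantum_commutative k (algop H) (tdual_lmodule (H := H)) (tdual_mul R)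
         (tflip R : tens (algop H) (algop H)) <->
  transmuted_cocomm R.
Proof.
have E (f g : 'Hom(H, k^o)) (h : H) :
   (\sw_(q1, q2 <- (tflip R : tens (algop H) (algop H)))
     tdual_mul R (@act _ _ (tdual_lmodule (H := H)) q2 g)
       (@act _ _ (tdual_lmodule (H := H)) q1 f) : 'Hom(H, k^o)) h =
   \sw_(a, b <- @braid k H R (adj_lmodule H) (adj_lmodule H)
      (transmuted_comul R h)) (f a * g b : k^o).
  transitivity (\sw_(q1, q2 <- tflip R) \sw_(a, b <- transmuted_comul R h)
     (g (adj_act q2 a) * f (adj_act q1 b) : k^o)).
    rewrite tliftE; apply: eq_tlift => q1 q2; rewrite tdual_mulE.
    by apply: eq_tlift => a b; rewrite !precompE !comp_lfunE.
  have lf (e : 'Hom(H, k^o)) (z : k) (V : lmodType k) (j : V -> H) : linear j ->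
      linear (fun x => e (j x) * z : k^o).
    by move=> lj c x y; rewrite lj linearP mulrDl scalerAl.
  have lf' (e : 'Hom(H, k^o)) (z : k) (V : lmodType k) (j : V -> H) : linear j ->
      linear (fun x => z * e (j x) : k^o).
    by move=> lj c x y; rewrite lj linearP mulrDr scalerAr.
  rewrite /tflip tlift_sw.
  transitivity (\sw_(r1, r2 <- R) \sw_(a, b <- transmuted_comul R h)
     (g (adj_act r1 a) * f (adj_act r2 b) : k^o)).
    apply: eq_tlift => r1 r2; rewrite tlift_pure //.
    by split=> w; apply: lin_tlift => a b; [apply: lf' | apply: lf]; lin.
  rewrite exchange_tlift /braid [RHS]tlift_sw; apply: eq_tlift => a b.
  rewrite [RHS]tlift_sw; apply: eq_tlift => r1 r2.
  rewrite tlift_pure; first by rewrite mulrC.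
  by split=> w; [apply: lf | apply: lf']; lin.
split=> [qc h | co f g].
  apply: tens_eq_dual => f g; rewrite -E -tdual_mulE.
  by rewrite -(qc f g).
by apply/lfunP=> h; rewrite E co tdual_mulE.
Qed.

End MuegerAndDual.

(** * Tensors as linear maps *)

Section Ev.
Context {k : fieldType}.
Implicit Types V W : vectType k.

(** [ev^~ t] is the linear map from W to V corresponding to [t]. *)
Definition ev V W (w : W) (t : tens V 'Hom(W, k^o)) : V :=
  tlift (fun v (xi : 'Hom(W, k^o)) => (xi w : k) *: v) t.
HB.instance Definition _ V W (w : W) :=
  GRing.Linear.copy (@ev V W w) (tlift (fun v (xi : 'Hom(W, k^o)) => (xi w : k) *: v)).

Lemma ev_bilin V W (w : W) : bilin (fun (v : V) (xi : 'Hom(W, k^o)) => (xi w : k) *: v).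
Proof.
split=> x c y z; first by rewrite scalerDr !scalerA mulrC.
by rewrite add_lfunE scale_lfunE scalerDl scalerA.
Qed.

Lemma ev_pure V W (w : W) (v : V) (xi : 'Hom(W, k^o)) :
  ev w (v \ox xi) = (xi w : k) *: v.
Proof. by rewrite /ev tlift_pure //; apply: ev_bilin. Qed.

Lemma ev_tlift V W (V' W' : vectType k) (F : V' -> W' -> tens V 'Hom(W, k^o)) w t :
  ev w (tlift F t) = \sw_(a, b <- t) ev w (F a b).
Proof. exact: (linear_tlift (ev w)). Qed.

Lemma ev_recon V W (t : tens V 'Hom(W, k^o)) :
  t = \sum_(i < \dim {:W}) (ev (vbasis fullv)`_i t \ox dual_basis i).
Proof.
pose L (t : tens V 'Hom(W, k^o)) :=
  \sum_(i < \dim {:W}) (ev (vbasis fullv)`_i t \ox dual_basis i).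
have lL : linear L.
  move=> c x y; rewrite /L scaler_sumr -big_split; apply: eq_bigr => i _ /=.
  by rewrite linearP; apply (tpure_bilin V _).1.
pose f : {linear tens V 'Hom(W, k^o) -> tens V 'Hom(W, k^o)} :=
  HB.pack L (GRing.isLinear.Build k _ _ _ _ lL).
rewrite -[RHS]/(f t) tlift_unique -[LHS]tlift_id; apply: eq_tlift => v xi /=.
rewrite /L {1}[xi]lfun_coord.
rewrite tpure_sumr; apply: eq_bigr => i _.
by rewrite tpureZr ev_pure tpureZl.
Qed.

Lemma ev_inj V W (t t' : tens V 'Hom(W, k^o)) :
  (forall w, ev w t = ev w t') -> t = t'.
Proof.
by move=> E; rewrite [LHS]ev_recon [RHS]ev_recon; apply: eq_bigr => i _; rewrite E.
Qed.

Definition ev2 V W V' W' (w : W) (w' : W')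
    (t : tens (tens V 'Hom(W, k^o)) (tens V' 'Hom(W', k^o))) : tens V V' :=
  \sw_(s, s' <- t) (ev w s \ox ev w' s').

Lemma ev2_pure V W V' W' (w : W) (w' : W') (s : tens V 'Hom(W, k^o))
  (s' : tens V' 'Hom(W', k^o)) : ev2 w w' (s \ox s') = ev w s \ox ev w' s'.
Proof. by rewrite /ev2 tlift_pure //; bil. Qed.

Lemma ev2_recon V W V' W' (t : tens (tens V 'Hom(W, k^o)) (tens V' 'Hom(W', k^o))) :
  t = \sum_(i < \dim {:W}) \sum_(j < \dim {:W'})
    tlift (fun v v' => (v \ox dual_basis i) \ox (v' \ox dual_basis j))
      (ev2 (vbasis fullv)`_i (vbasis fullv)`_j t).
Proof.
pose L (t : tens (tens V 'Hom(W, k^o)) (tens V' 'Hom(W', k^o))) :=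
  \sum_(i < \dim {:W}) \sum_(j < \dim {:W'})
    tlift (fun v v' => (v \ox dual_basis i) \ox (v' \ox dual_basis j))
      (ev2 (vbasis fullv)`_i (vbasis fullv)`_j t).
have lL : linear L.
  move=> c x y; rewrite /L scaler_sumr -big_split; apply: eq_bigr => i _ /=.
  rewrite scaler_sumr -big_split; apply: eq_bigr => j _ /=.
  by rewrite /ev2 !linearP.
pose f := HB.pack_for {linear tens (tens V 'Hom(W, k^o)) (tens V' 'Hom(W', k^o)) -> _}
  L (GRing.isLinear.Build k _ _ _ _ lL).
rewrite -[RHS]/(f t) tlift_unique -[LHS]tlift_id; apply: eq_tlift => s s' /=.
rewrite /L {1}[s]ev_recon tpure_suml; apply: eq_bigr => i _ /=.
rewrite {1}[s']ev_recon tpure_sumr; apply: eq_bigr => j _ /=.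
by rewrite ev2_pure tlift_pure //; bil.
Qed.

Lemma ev2_inj V W V' W' (t t' : tens (tens V 'Hom(W, k^o)) (tens V' 'Hom(W', k^o))) :
  (forall w w', ev2 w w' t = ev2 w w' t') -> t = t'.
Proof.
move=> E; rewrite [LHS]ev2_recon [RHS]ev2_recon.
by apply: eq_bigr => i _; apply: eq_bigr => j _; rewrite E.
Qed.

Lemma ev2_tlift V W (V' W' V1 W1 : vectType k) (w : W) (w' : W')
    (F : V1 -> W1 -> tens (tens V 'Hom(W, k^o)) (tens V' 'Hom(W', k^o))) t :
  ev2 w w' (tlift F t) = \sw_(a, b <- t) ev2 w w' (F a b).
Proof. exact: tlift_sw. Qed.

Lemma ev_tmapl V W V' (f : 'Hom(V, V')) (w : W) t :
  ev w (tmap f \1%VF t) = f (ev w t).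
Proof.
rewrite -(tlift_id t) tmap_tlift !ev_tlift [RHS](linear_tlift f).
apply: eq_tlift => v xi.
by rewrite tmapE id_lfunE !ev_pure linearZ.
Qed.

Lemma ev_tmapr V W W' (f : 'Hom(W, W')) (w : W) (t : tens V 'Hom(W', k^o)) :
  ev w (tmap \1%VF (precomp f) t) = ev (f w) t.
Proof.
rewrite -(tlift_id t) tmap_tlift !ev_tlift; apply: eq_tlift => v xi.
by rewrite tmapE id_lfunE !ev_pure precompE comp_lfunE.
Qed.

Definition tens_of_lfun V W (f : 'Hom(W, V)) : tens V 'Hom(W, k^o) :=
  \sum_(i < \dim {:W}) (f (vbasis fullv)`_i \ox dual_basis i).

Lemma ev_tens_of_lfun V W (f : 'Hom(W, V)) w : ev w (tens_of_lfun f) = f w.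
Proof.
rewrite [in RHS](coord_vbasis (memvf w)) [RHS]linear_sum.
rewrite [LHS](linear_sum (ev w)); apply: eq_bigr => i _ /=.
by rewrite ev_pure dual_basisE linearZ.
Qed.

Lemma tens_of_lfun_linear V W : linear (@tens_of_lfun V W).
Proof.
move=> c f g; apply: ev_inj => w; rewrite [RHS]linearP /= !ev_tens_of_lfun.
by rewrite add_lfunE scale_lfunE.
Qed.

Lemma dual_tens_linear V W : linear (@dual_tens k V W).
Proof.
move=> c f g; rewrite /dual_tens scaler_sumr -big_split; apply: eq_bigr => i _ /=.
rewrite scaler_sumr -big_split; apply: eq_bigr => j _ /=.
by rewrite add_lfunE scale_lfunE scalerDl scalerA.
Qed.

HB.instance Definition _ V W := GRing.isLinear.Build k 'Hom(tens V W, k^o)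
  (tens 'Hom(W, k^o) 'Hom(V, k^o)) _ (@dual_tens k V W) (@dual_tens_linear V W).

Lemma dual_tens_eval V W (phi : 'Hom(tens V W, k^o)) x y :
  tlift (fun (eta : 'Hom(W, k^o)) (xi : 'Hom(V, k^o)) => xi x * eta y : k^o)
    (dual_tens phi) = phi (x \ox y).
Proof.
have bF : bilin (fun (eta : 'Hom(W, k^o)) (xi : 'Hom(V, k^o)) => xi x * eta y : k^o).
  split=> u c v w; rewrite add_lfunE scale_lfunE.
    by rewrite mulrDr scalerAr.
  by rewrite mulrDl scalerAl.
rewrite /dual_tens [LHS]linear_sum [in RHS](coord_vbasis (memvf x)).
rewrite tpure_suml [RHS]linear_sum.
apply: eq_bigr => i _ /=; rewrite [LHS]linear_sum.
rewrite tpureZl [RHS]linearZ /= [in RHS](coord_vbasis (memvf y)).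
rewrite tpure_sumr linear_sum scaler_sumr.
apply: eq_bigr => j _ /=; rewrite tpureZr !linearZ /=.
rewrite tlift_pure // !dual_basisE scalerA.
by rewrite [X in _ = X *: _]mulrC; exact: mulrC.
Qed.

End Ev.

(** * The end of the X \ox X^* *)

Section AdjointEnd.
Context {k : fieldType} {H : hopfAlgebra k}.
Implicit Types X Y : lmodule H.
Local Notation S := (@antipode k H).
Local Notation XX X := (tens_lmodule X (dual_lmodule X)).

Lemma ev_act X (a : H) (t : tens X 'Hom(X, k^o)) x :
  ev x (tens_act X (dual_lmodule X) a t) =
  \sw_(c, d <- comul a) act c (ev (act (S d) x) t).
Proof.
rewrite /tens_act tliftE ev_tlift; apply: eq_tlift => c d.
rewrite -[in LHS](tlift_id t) tmap_tlift ev_tlift.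
rewrite -[in RHS](tlift_id t) ev_tlift [RHS](linear_tlift (act c)).
apply: eq_tlift => y xi.
by rewrite tmapE !ev_pure linearZ /= /dual_act precompE comp_lfunE.
Qed.

Definition adj_end X : 'Hom(adj_lmodule H, XX X) :=
  linfun (fun h : H => tens_of_lfun (act h : 'End(X)) : tens X 'Hom(X, k^o)).

Lemma ev_adj_end X h x : ev x (adj_end X h) = act h x.
Proof.
rewrite linfunE_lin ?ev_tens_of_lfun //.
by move=> c u v; rewrite linearP tens_of_lfun_linear.
Qed.

Lemma adj_end_inj X (h : H) (t : tens X 'Hom(X, k^o)) :
  (forall x, act h x = ev x t) -> adj_end X h = t.
Proof. by move=> E; apply: ev_inj => x; rewrite ev_adj_end E. Qed.

Lemma adj_end_hom X : lmodule_hom (adj_end X).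
Proof.
move=> a h; apply: adj_end_inj => x; rewrite /= ev_act adj_actE.
rewrite (linear_tlift (@act k H X)) tliftE; apply: eq_tlift => c d.
by rewrite ev_adj_end !actM.
Qed.

Lemma adj_end_dinatural : dinatural adj_end.
Proof.
move=> X Y f hf h; apply: ev_inj => x.
by rewrite ev_tmapl ev_tmapr !ev_adj_end hf.
Qed.

Local Notation reg := (@reg_lmodule k H).

Definition ev_at1 : 'Hom(tens H 'Hom(H, k^o), H) := linfun (ev (1 : H)).

Lemma ev_at1_adj_end (h : H) : ev_at1 (adj_end reg h) = h.
Proof. by rewrite lfunE /= (ev_adj_end (X := reg)) /= lfunE /= mulr1. Qed.

(** The action h |-> h x is a morphism from the regular module, so by
    dinaturality the component at X is determined by the one at the regular
    module; evaluated at 1, the latter is an element of H. *)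
Lemma dinatural_act (W : lmodule H) (q : forall X, 'Hom(W, XX X)) X w x :
  dinatural q -> act (ev_at1 (q reg w)) x = ev x (q X w).
Proof.
move=> dq; pose f : 'Hom(reg, X) := linfun (fun h : H => act h x).
have fE h : f h = act h x.
  by rewrite linfunE_lin // => c u v; rewrite linearP add_lfunE scale_lfunE.
have hf : lmodule_hom f by move=> a h; rewrite !fE /= lfunE /= actM.
have := congr1 (ev (1 : H)) (dq reg X f hf w).
by rewrite (ev_tmapl f) (ev_tmapr f) !fE act1 lfunE.
Qed.

Lemma adj_is_end : is_end adj_end.
Proof.
split; [exact: adj_end_hom | exact: adj_end_dinatural | move=> W q hq dq].
exists (ev_at1 \o q reg)%VF; split; last first.
  move=> f [_ E]; apply/lfunP=> w.
  by rewrite comp_lfunE -[RHS]ev_at1_adj_end -(E reg w).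
split=> [a w | X w]; rewrite !comp_lfunE.
  have -> : q reg (act a w) = tens_act reg (dual_lmodule reg) a (q reg w).
    exact: (hq reg).
  rewrite [LHS]lfunE /= (ev_act (X := reg)) adj_actE.
  apply: eq_tlift => c d.
  by rewrite -(dinatural_act _ _ dq) !reg_actE mulr1 mulrA.
by apply: adj_end_inj => x; rewrite (dinatural_act _ _ dq).
Qed.

End AdjointEnd.

(** * The coproduct of the end *)

Section Coproduct.
Context {k : fieldType} {H : hopfAlgebra k}.
Variable R : tens H H.
Hypothesis Rqt : quasi_triangular R.
Local Notation S := (@antipode k H).
Local Notation Had := (adj_lmodule H).

Lemma transmuted_comul_linear : linear (transmuted_comul R).
Proof. by rewrite /transmuted_comul; lin. Qed.

Lemma tens_act_tlift (X Y : lmodule H) (V W : vectType k) a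
    (F : V -> W -> tens X Y) t :
  tens_act X Y a (tlift F t) = \sw_(u, v <- t) tens_act X Y a (F u v).
Proof. exact: (linear_tlift (tens_act X Y a)). Qed.

Lemma tens_act_pure (X Y : lmodule H) a (x : X) (y : Y) :
  tens_act X Y a (x \ox y) = \sw_(u, v <- comul a) (act u x \ox act v y).
Proof. by rewrite /tens_act tliftE; apply: eq_tlift => u v; rewrite tmapE. Qed.

(** The right-hand side is
      g_(1) h_(1) S(R^2) S(g_(2)) \ox g_(3).(R^1.h_(2))
        = g_(1) h_(1) S(g_(3)) S(R^2) \ox R^1.(g_(2).h_(2))
        = g_(1) h_(1) S(g_(4)) S(R^2) \ox R^1.(g_(2) h_(2) S(g_(3))),
    by quasi-cocommutativity, and this is the left-hand side because S is
    anti-comultiplicative. *)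
Lemma transmuted_comul_hom g h :
  transmuted_comul R (adj_act g h) = tens_act Had Had g (transmuted_comul R h).
Proof.
pose T (h1 h2 c1 c2 d1 d2 : H) := \sw_(r1, r2 <- R)
  ((c1 * h1 * S (r2 * d2)) \ox adj_act r1 (c2 * h2 * S d1)).
transitivity (\sw_(h1, h2 <- comul h) \sw_(c, d <- comul g)
  \sw_(c1, c2 <- comul c) \sw_(d1, d2 <- comul d) T h1 h2 c1 c2 d1 d2).
  rewrite adj_actE /transmuted_comul (linear_tlift comul) tlift_sw.
  rewrite [RHS]exchange_tlift; apply: eq_tlift => c d /=.
  rewrite comulM_sw; last by bil.
  rewrite comulM_sw; last by bil.
  rewrite [RHS]exchange_tlift; apply: eq_tlift => c1 c2.
  apply: eq_tlift => h1 h2; rewrite comul_antipode tlift_sw.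
  apply: eq_tlift => d1 d2; rewrite tlift_pure; last by bil.
  by apply: eq_tlift => r1 r2; rewrite antipodeM !mulrA.
rewrite /transmuted_comul tens_act_tlift; apply: eq_tlift => h1 h2.
rewrite (comulA (T := fun c1 c2 d => \sw_(d1, d2 <- comul d) T h1 h2 c1 c2 d1 d2));
  [ | by move=> ? ?; rewrite /T; lin.. ].
transitivity (\sw_(c, d <- comul g) \sw_(p, q <- comul d) \sw_(r1, r2 <- R)
   ((c * h1 * S (r2 * q)) \ox adj_act (r1 * p) h2)).
  apply: eq_tlift => c1 e.
  rewrite -(comulA (T := fun c2 d1 d2 => T h1 h2 c1 c2 d1 d2));
    [ | by move=> ? ?; rewrite /T; lin.. ].
  apply: eq_tlift => p q; rewrite /T.
  rewrite exchange_tlift [RHS]/=; apply: eq_tlift => r1 r2.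
  rewrite adj_actM [adj_act p h2]adj_actE (linear_tlift (adj_act r1)).
  by rewrite tpure_tliftr.
transitivity (\sw_(c, d <- comul g) \sw_(p, q <- comul d) \sw_(r1, r2 <- R)
   ((c * h1 * S r2 * S p) \ox adj_act (q * r1) h2)).
  apply: eq_tlift => c d; rewrite exchange_tlift.
  rewrite (comul_R_sw Rqt (F := fun x y => (c * h1 * S y) \ox adj_act x h2));
    last by bil.
  rewrite exchange_tlift; apply: eq_tlift => p q; apply: eq_tlift => r1 r2.
  by rewrite antipodeM !mulrA.
rewrite -(comulA (T := fun c p q => \sw_(r1, r2 <- R)
   ((c * h1 * S r2 * S p) \ox adj_act (q * r1) h2)));
  [ | by move=> ? ?; lin.. ].
rewrite tens_act_tlift.
under eq_tlift do rewrite exchange_tlift.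
rewrite exchange_tlift; apply: eq_tlift => r1 r2.
rewrite tens_act_pure; apply: eq_tlift => a q /=.
rewrite [X in X \ox _]adj_actE tpure_tliftl.
by apply: eq_tlift => c p; rewrite adj_actM !mulrA.
Qed.

(** In the values of the linear maps, R^2 acting on X^* becomes S(R^2) acting
    on the argument, and the action of R^1 on Y \ox Y^* becomes R^1_(1) acting
    on the value and S(R^1_(2)) acting on the argument. *)
Lemma ev2_split_end (X Y : lmodule H) x y
   (z : tens (tens X Y) 'Hom(tens X Y, k^o)) :
  ev2 x y (@split_end k H R X Y z : tens (tens X 'Hom(X, k^o)) (tens Y 'Hom(Y, k^o))) =
  \sw_(r1, r2 <- R) \sw_(c, d <- comul r1)
    tmap \1%VF (act c) (ev (act (S r2) x \ox act (S d) y) z).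
Proof.
transitivity (tlift (fun (xy : tens X Y) (phi : 'Hom(tens X Y, k^o)) =>
    \sw_(r1, r2 <- R) \sw_(c, d <- comul r1)
    ((phi (act (S r2) x \ox act (S d) y) : k) *: tmap \1%VF (act c) xy)) z);
  last first.
  rewrite exchange_tlift; apply: eq_tlift => r1 r2.
  rewrite exchange_tlift; apply: eq_tlift => c d.
  rewrite -[in RHS](tlift_id z) ev_tlift tmap_tlift; apply: eq_tlift => xy phi.
  by rewrite ev_pure linearZ.
rewrite /split_end ev2_tlift; apply: eq_tlift => xy phi.
transitivity (\sw_(x', y' <- xy) \sw_(r1, r2 <- R) \sw_(c, d <- comul r1)
   ((phi (act (S r2) x \ox act (S d) y) : k) *: (x' \ox act c y'))); last first.
  rewrite exchange_tlift; apply: eq_tlift => r1 r2.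
  rewrite exchange_tlift; apply: eq_tlift => c d.
  rewrite -[in RHS](tlift_id xy) tmap_tlift scaler_tlift.
  by apply: eq_tlift => x' y'; rewrite tmapE id_lfunE.
rewrite ev2_tlift; apply: eq_tlift => x' y'.
transitivity (tlift (fun (eta : 'Hom(Y, k^o)) (xi : 'Hom(X, k^o)) =>
   \sw_(r1, r2 <- R) \sw_(c, d <- comul r1)
   ((xi (act (S r2) x) * eta (act (S d) y) : k) *: (x' \ox act c y')))
   (dual_tens phi)); last first.
  rewrite exchange_tlift; apply: eq_tlift => r1 r2.
  rewrite exchange_tlift; apply: eq_tlift => c d.
  rewrite -dual_tens_eval.
  pose sc : {linear k^o -> tens X Y} := HB.pack_for {linear k^o -> tens X Y}
    (fun l : k^o => (l : k) *: (x' \ox act c y'))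
    (GRing.isLinear.Build k _ _ _ _ (lin_scalel (x' \ox act c y') (@lin_id k k^o))).
  by rewrite [RHS](linear_tlift sc).
rewrite ev2_tlift; apply: eq_tlift => eta xi.
rewrite ev2_tlift braid_pure tlift_sw; apply: eq_tlift => r1 r2.
rewrite tlift_pure; last first.
  by split=> v; rewrite /ev2; lin.
rewrite ev2_pure ev_pure /=.
rewrite ev_act tpure_tliftr; apply: eq_tlift => c d.
rewrite ev_pure linearZ /= tpureZr tpureZl scalerA mulrC.
by rewrite /dual_act precompE comp_lfunE.
Qed.

Lemma adj_end_comul (X Y : lmodule H) h :
  tmap (adj_end X) (adj_end Y) (transmuted_comul R h) =
  split_end R (adj_end (tens_lmodule X Y) h).
Proof.
apply: ev2_inj => x y; rewrite ev2_split_end.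
transitivity (\sw_(a, b <- transmuted_comul R h) (act a x \ox act b y)).
  rewrite -[X in tmap _ _ X]tlift_id tmap_tlift ev2_tlift; apply: eq_tlift => a b.
  by rewrite tmapE ev2_pure !ev_adj_end.
rewrite [LHS]tlift_sw.
transitivity (\sw_(r1, r2 <- R) \sw_(c, d <- comul r1) \sw_(a, b <- comul h)
   (act (a * S r2) x \ox act (c * b * S d) y)); last first.
  apply: eq_tlift => r1 r2; apply: eq_tlift => c d.
  rewrite (ev_adj_end (X := tens_lmodule X Y)) /= tens_act_pure tmap_tlift.
  apply: eq_tlift => a b.
  by rewrite tmapE id_lfunE !actM.
under [RHS]eq_tlift do rewrite exchange_tlift.
rewrite [RHS]exchange_tlift; apply: eq_tlift => a b.
rewrite tlift_sw; apply: eq_tlift => r1 r2; rewrite tlift_pure; last by bil.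
rewrite adj_actE (linear_tlift (@act k H Y)) tliftE tpure_tliftr.
by apply: eq_tlift => c d.
Qed.

Lemma transmuted_comul_end_comul :
  is_end_comul R (adj_end (H := H))
    (linfun (transmuted_comul R) : 'Hom(Had, tens_lmodule Had Had)).
Proof.
have E h : (linfun (transmuted_comul R) : 'Hom(Had, tens_lmodule Had Had)) h =
    transmuted_comul R h by apply: linfunE_lin; exact: transmuted_comul_linear.
split=> [g h | X Y h]; first by rewrite !E transmuted_comul_hom.
by rewrite E adj_end_comul.
Qed.

Lemma braid_natural (V V' W W' : lmodule H) (f : 'Hom(V, V')) (g : 'Hom(W, W')) t :
  lmodule_hom f -> lmodule_hom g ->
  @braid k H R V' W' (tmap f g t) = tmap g f (@braid k H R V W t).
Proof.
move=> hf hg; rewrite -(tlift_id t) tmap_tlift !braid_tlift tmap_tlift.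
apply: eq_tlift => v w; rewrite tmapE !braid_pure tmap_tlift.
by apply: eq_tlift => r1 r2; rewrite tmapE hf hg.
Qed.

(** The comparison maps between the end (H, ad) and any other end carry one
    coproduct to the other, because the component at the regular module of the
    end (H, ad) has a retraction, the evaluation at 1. *)
Lemma almost_symmetric_cocomm : almost_symmetric R <-> transmuted_cocomm R.
Proof.
have E h : (linfun (transmuted_comul R) : 'Hom(Had, tens_lmodule Had Had)) h =
    transmuted_comul R h by apply: linfunE_lin; exact: transmuted_comul_linear.
split=> [[U [p [D [[ph pd pu] [Dh DE] Dc]]]] h | co]; last first.
  exists Had, (@adj_end k H), (linfun (transmuted_comul R)); split.
  - exact: adj_is_end.
  - exact: transmuted_comul_end_comul.
  - by move=> u; rewrite E co.
pose reg := @reg_lmodule k H.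
have [f [[_ fE] _]] :=
  pu Had (@adj_end k H) (@adj_end_hom k H) (@adj_end_dinatural k H).
have [g [[gh gE] _]] := end_universal (@adj_is_end k H) ph pd.
suff <- : tmap g g (D (f h)) = transmuted_comul R h.
  by rewrite (braid_natural _ gh gh) Dc.
have inj (s t : tens H H) :
    tmap (adj_end reg) (adj_end reg) s = tmap (adj_end reg) (adj_end reg) t ->
    s = t.
  move/(congr1 (tmap (ev_at1 (H := H)) (ev_at1 (H := H)))); rewrite !tmap_comp.
  have -> : (ev_at1 (H := H) \o adj_end reg)%VF = \1%VF.
    by apply/lfunP=> x; rewrite comp_lfunE id_lfunE ev_at1_adj_end.
  have id1 x : tmap \1%VF \1%VF x = x :> tens H H.
    rewrite -[in RHS](tlift_id x) -[in LHS](tlift_id x) tmap_tlift.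
    by apply: eq_tlift => a b; rewrite tmapE !id_lfunE.
  by rewrite !id1.
apply: inj; rewrite tmap_comp.
have -> : (adj_end reg \o g)%VF = p reg.
  by apply/lfunP=> x; rewrite comp_lfunE gE.
by rewrite DE fE adj_end_comul.
Qed.

End Coproduct.

Theorem proposition4p2 (k : fieldType) (k_char0 : [pchar k] =i pred0)
    (H : hopfAlgebra k) (R : tens H H) (R_qt : quasi_triangular R) :
  [<-> almost_symmetric R;
       almost_triangular R;
       @quantum_commutative k (algop H) (tdual_lmodule (H := H)) (tdual_mul R)
         (tflip R : tens (algop H) (algop H));
       forall h : H,
         \sw_(r1, r2 <- R) \sw_(s1, s2 <- R)
           (adj_act (s2 * r1) h \ox (s1 * r2)) = h \ox (1 : H)] /\
  ((forall h : H,
      \sw_(r1, r2 <- R) \sw_(s1, s2 <- R)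
        (adj_act (s2 * r1) h \ox (s1 * r2)) = h \ox (1 : H)) <->
   in_muger_center R (adj_lmodule H)).
Proof.
split; last exact: monodromy_trivial_muger.
have mt : monodromy_trivial R <-> transmuted_cocomm R.
  split; [exact: cocomm_of_monodromy | exact: monodromy_of_cocomm].
tfae.
- move/(almost_symmetric_cocomm R_qt)/mt/(centl_of_monodromy_trivial R_qt).
  by move/(almost_triangularE R_qt).
- move/(almost_triangularE R_qt)/(monodromy_trivial_of_centl R_qt)/mt.
  by move/quantum_commutative_cocomm.
- by move/quantum_commutative_cocomm/mt.
- by move/mt/(almost_symmetric_cocomm R_qt).
Qed.
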